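(* (Cubical Gale Evenness Criterion) Let $n\ge d\ge 2$. The facets of $C_d^n$ are exactly those given (in the sense of the context) by the subsets $$\alpha\subseteq\{-1,+1,-2,+2,\ldots,-n,+n\},\qquad \#\alpha=n-d+1,\qquad \alpha\cap(-\alpha)=\emptyset,$$ of one of the following forms. Case $p=0$: $\pm1\notin\alpha$, and $|\alpha|:=\{|a|:a\in\alpha\}$ satisfies the (simplicial) Gale evenness criterion: for any two $i<j$ in $|\alpha|$, the number of $k$ with $i<k<j$ and $k\notin|\alpha|$ is even. Case $1\le p\le n-d+1$: $$\alpha=\{-1,+2,\ldots,(-1)^{p-1}(p-1),\ \sigma\cdot p\}\cup\alpha^{(p)},$$ where $\sigma\in\{-1,+1\}$, $\#\alpha^{(p)}=n-d+1-p$, and, if $\alpha^{(p)}\neq\emptyset$ (that is, if $p\le n-d$), then, writing $|\alpha^{(p)}|:=\{|a|:a\in\alpha^{(p)}\}$, (1) $\min|\alpha^{(p)}|>p+1$; (2) $|\alpha^{(p)}|$ satisfies the (simplicial) Gale evenness criterion: for any two $i<j$ in $|\alpha^{(p)}|$, the number of $k$ with $i<k<j$ and $k\notin|\alpha^{(p)}|$ is even; (3) if $\sigma=(-1)^{p+1}$, then $\min|\alpha^{(p)}|-p$ is even; if $\sigma=(-1)^{p}$, then $\min|\alpha^{(p)}|-p$ is odd.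
   Context: For $0<\varepsilon\le 1$ let $C^n(\varepsilon)\subseteq\mathbb{R}^n$ be the combinatorial $n$-cube consisting of all $x\in\mathbb{R}^n$ with $$(-1)^k\sum_{j=1}^{k-1}\binom{k-2}{j-1}x_j+\varepsilon|x_k|\le\frac{2^{\binom{k}{2}}}{\varepsilon^{k-1}}\qquad\text{for }1\le k\le n.$$ Let $\pi:\mathbb{R}^n\to\mathbb{R}^d$, $(x_1,\dots,x_n)\mapsto(x_{n-d+1},\dots,x_n)$, and let $C_d^n:=\pi(C^n(\varepsilon))$ for sufficiently small $\varepsilon>0$; this is a cubical $d$-polytope (all its proper faces are combinatorial cubes), and each facet of $C_d^n$ is the bijective image under $\pi$ of a unique $(d-1)$-face of $C^n(\varepsilon)$. A set $\alpha\subseteq\{\pm1,\ldots,\pm n\}$ with $\#\alpha=n-d+1$ and $\alpha\cap(-\alpha)=\emptyset$ encodes the $(d-1)$-face $F_\alpha$ of $C^n(\varepsilon)$ consisting of all $x\in C^n(\varepsilon)$ with $$(-1)^k\sum_{j=1}^{k-1}\binom{k-2}{j-1}x_j+\sigma_k\,\varepsilon\, x_k=\frac{2^{\binom{k}{2}}}{\varepsilon^{k-1}}\qquad\text{for all } k\in\{1,\dots,n\},\ \sigma_k\in\{+1,-1\}\text{ with }\sigma_k k\in\alpha .$$ ''A facet is given by $\alpha$'' means that the facet equals $\pi(F_\alpha)$. *)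

(* Defs.v *)
From mathcomp Require Import all_boot all_order all_algebra finmap.
From mathcomp Require Import boolp classical_sets reals.

Set Implicit Arguments.
Unset Strict Implicit.
Unset Printing Implicit Defensive.

Import Order.TTheory GRing.Theory Num.Theory.

Local Open Scope classical_set_scope.
Local Open Scope ring_scope.

(* Coordinates are 0-based: the coordinate x_k (1 <= k <= n) of a point
   x : 'rV_n is x 0 i, where i : 'I_n has value k - 1.  Signed indices
   (elements of {-n, ..., -1, 1, ..., n}) keep their values, as integers. *)

Section Polytopes.
Variables (R : realType) (d : nat).
Implicit Types (P F A : set 'rV[R]_d).

(* V is the direction of the affine hull of A, k its dimension; there is no
   such k when A is empty. *)
Definition has_affdim A (k : nat) : Prop :=
  A !=set0 /\
  exists V : {vspace 'rV[R]_d},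
    [/\ forall x y, A x -> A y -> x - y \in V,
        forall W : {vspace 'rV[R]_d},
          (forall x y, A x -> A y -> x - y \in W) -> (V <= W)%VS
      & \dim V = k].

(* The column c stands for the linear functional x |-> x *m c. *)
Definition face P F : Prop :=
  exists (c : 'cV[R]_d) (b : R),
    (forall x, P x -> (x *m c) 0 0 <= b) /\
    F = [set x | P x /\ (x *m c) 0 0 = b].

Definition facet P F : Prop :=
  face P F /\ exists k, has_affdim P k.+1 /\ has_affdim F k.

End Polytopes.

Section Cube.
Variables (R : realType) (n : nat).
Implicit Types (e : R) (x : 'rV[R]_n) (i : 'I_n).

(* With k = i + 1:  (-1)^k \sum_(1 <= j <= k-1) binom(k-2, j-1) x_j;
   the sum is empty when i = 0. *)
Definition cube_form x i : R :=
  (-1) ^+ i.+1 * \sum_(j < n | (j < i)%N) 'C(i.-1, j)%:R * x 0 j.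

Definition cube_bound e i : R := 2 ^+ 'C(i.+1, 2) / e ^+ i.

Definition cube e : set 'rV[R]_n :=
  [set x | forall i, cube_form x i + e * `|x 0 i| <= cube_bound e i].

Definition cube_face e (alpha : {fset int}) : set 'rV[R]_n :=
  [set x | cube e x /\
    forall i (s : int), s = 1 \/ s = -1 -> s * (i.+1)%:Z \in alpha ->
      cube_form x i + s%:~R * e * x 0 i = cube_bound e i].

End Cube.

(* The last d coordinates: column j of the image is column n - d + j of x. *)
Definition proj (R : realType) (n d : nat) (dn : (d <= n)%N) (x : 'rV[R]_n) :
    'rV[R]_d :=
  colsub (fun j : 'I_d => cast_ord (subnK dn) (rshift (n - d) j)) x.

Definition ncp (R : realType) (n d : nat) (dn : (d <= n)%N) (e : R) :
    set 'rV[R]_d :=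
  proj dn @` @cube R n e.

Definition abs_fset (A : {fset int}) : {fset nat} :=
  [fset `|a|%N | a in A]%fset.

Definition signed_subset (n d : nat) (alpha : {fset int}) : Prop :=
  [/\ forall a, a \in alpha -> (1 <= `|a| <= n)%N,
      #|` alpha| = (n - d + 1)%N
    & (alpha `&` [fset - a | a in alpha] = fset0)%fset].

Definition simplicial_gale (A : {fset nat}) : Prop :=
  forall i j : nat, i \in A -> j \in A -> (i < j)%N ->
    ~~ odd (count (fun k => k \notin A) (index_iota i.+1 j)).

Definition is_min (A : {fset nat}) (m : nat) : Prop :=
  m \in A /\ forall j, j \in A -> (m <= j)%N.

Definition gale_case0 (alpha : {fset int}) : Prop :=
  [/\ 1 \notin alpha, -1 \notin alpha & simplicial_gale (abs_fset alpha)].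

Definition gale_case (n d p : nat) (alpha : {fset int}) : Prop :=
  exists (s : int) (beta : {fset int}),
    [/\ s = 1 \/ s = -1,
        (alpha = [fset (-1) ^+ j * j%:Z | j in iota 1 p.-1]
                 `|` [fset s * p%:Z] `|` beta)%fset,
        #|` beta| = (n - d + 1 - p)%N
      & beta != fset0 ->
        exists m : nat,
          [/\ is_min (abs_fset beta) m,
              (p + 1 < m)%N,
              simplicial_gale (abs_fset beta),
              s = (-1) ^+ (p + 1) -> ~~ odd (m - p)
            & s = (-1) ^+ p -> odd (m - p)]].

Definition cubical_gale (n d : nat) (alpha : {fset int}) : Prop :=
  gale_case0 alpha \/
  exists p : nat, (1 <= p <= n - d + 1)%N /\ gale_case n d p alpha.

(* Main.v *)
Require Import Defs.
From mathcomp Require Import all_boot all_order all_algebra finmap.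
From mathcomp Require Import boolp classical_sets reals.
From mathcomp Require Import ring lra zify.
Set Implicit Arguments.
Unset Strict Implicit.
Unset Printing Implicit Defensive.
Import Order.TTheory GRing.Theory Num.Theory.
Local Open Scope classical_set_scope.
Local Open Scope ring_scope.

(* Write the k-th pair of inequalities as form_k(x) + s e x_k <= bound_k with
   s = +-1.  The system is triangular: |form_k| < bound_k whenever the earlier
   inequalities hold, so every choice of tight inequalities (at most one sign for
   each k) is realised, and every linear functional on R^n is a unique nonnegative
   combination of rows, at most one sign for each k.  Hence the faces of the
   projection are the images of the faces F_alpha such that a positive combination
   of the rows in alpha vanishes on the m = n - d forgotten coordinates, and the
   facets are those for which the truncated rows have a one-dimensional space of
   relations.

   For small e any m + 1 truncated rows have, up to scaling, a single relation,
   with all coefficients nonzero.  Suppose that the rows are 1, ..., p and rows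
   k > p + 1.  Scaling the first p rows and columns by powers of e gives a matrix
   polynomial in e whose value at e = 0 decouples: columns j < p link the
   coefficients of rows j and j + 1, and the other columns form a generalised
   Vandermonde system in the binomials C(k - 2, j - 1), in which row p enters
   through the node k = p + 1.  The weights of a Vandermonde relation alternate in
   sign, so the signs of the coefficients can be read off, and the relation is
   positive exactly when alpha satisfies the cubical Gale evenness criterion. *)

(** * Small parameters and one-parameter families of matrices *)

Section SmallParameter.
Variable R : realType.

(** The minimum of finitely many thresholds is still positive; this yields one [e0] for all index
    sets and signs. *)
Lemma fin_small (T : finType) (P : T -> R -> Prop) :
  (forall t, exists2 e0 : R, 0 < e0 & forall e, 0 < e -> e < e0 -> P t e) ->
  exists2 e0 : R, 0 < e0 & forall e, 0 < e -> e < e0 -> forall t, P t e.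
Proof.
move=> H; suff [e0 e0p He0] : exists2 e0 : R, 0 < e0 &
    forall e, 0 < e -> e < e0 -> forall t, t \in enum T -> P t e.
  by exists e0 => // e ep ee0 t; apply: He0 => //; rewrite mem_enum.
elim: (enum T) => [|t s [e1 e1p He1]]; first by exists 1.
have [e2 e2p He2] := H t.
exists (Num.min e1 e2) => [|e ep]; first by rewrite lt_min e1p.
rewrite lt_min => /andP[l1 l2] u; rewrite inE => /orP[/eqP->|us].
  exact: He2.
exact: He1.
Qed.

Lemma horner_bounded01 (p : {poly R}) :
  exists K, forall x, 0 <= x -> x <= 1 -> `|p.[x]| <= K.
Proof.
elim/poly_ind: p => [|p c [K HK]].
  by exists 0 => x _ _; rewrite horner0 normr0.
exists (K + `|c|) => x x0 x1; rewrite hornerMXaddC.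
apply: (le_trans (ler_normD _ _)); rewrite lerD2r normrM (ger0_norm x0).
by apply: le_trans (HK x x0 x1); rewrite ler_piMr.
Qed.

(** Split off the constant term [c]: the rest is [e] times a quantity bounded on [0, 1], hence
    smaller than [c] in absolute value for small [e]. *)
Lemma horner_sign_near0 (p : {poly R}) : p.[0] != 0 ->
  exists2 e0 : R, 0 < e0 & forall e, 0 < e -> e < e0 -> 0 < p.[e] * p.[0].
Proof.
elim/poly_ind: p => [|p c _]; first by rewrite horner0 eqxx.
rewrite hornerMXaddC mulr0 add0r => c0.
have [K HK] := horner_bounded01 p.
have K0 : 0 <= K by apply: le_trans (HK 0 _ _).
have nc : 0 < `|c| by rewrite normr_gt0.
exists (Num.min 1 (`|c| / (K + 1))) => [|e ep].
  by rewrite lt_min ltr01 divr_gt0 //; lra.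
rewrite lt_min => /andP[e1]; rewrite ltr_pdivlMr; last lra.
move=> eK; rewrite hornerMXaddC mulrDl.
have := HK e (ltW ep) (ltW e1); set q := p.[e] => qK.
have : `|q * e| < `|c|.
  rewrite normrM (gtr0_norm ep); apply: le_lt_trans eK.
  by rewrite mulrC ler_pM2l //; lra.
move=> qe; have : `|q * e * c| < c * c.
  have -> : c * c = `|c| * `|c| by rewrite -normrM ger0_norm // -expr2 sqr_ge0.
  by rewrite normrM ltr_pM2r.
by rewrite ltr_norml => /andP[]; lra.
Qed.

End SmallParameter.

(** * Kernels of matrices with one more row than columns *)

Section SignedMinors.

(** The generalised cross product of the columns. It is polynomial in the entries, so it gives a
    kernel vector that varies polynomially with a parameter. *)
Definition signed_minors (A : comNzRingType) m (P : 'M[A]_(m.+1, m)) : 'rV[A]_m.+1 :=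
  \row_l ((-1) ^+ l * \det (row' l P)).

Lemma signed_minors_ker (A : comNzRingType) m (P : 'M[A]_(m.+1, m)) :
  signed_minors P *m P = 0.
Proof.
apply/rowP => j; rewrite !mxE.
(* Repeating column [j] makes the determinant vanish; its expansion along the added column is entry
   [j] of the product. *)
pose M : 'M[A]_m.+1 := row_mx (col j P) P.
have M0 : \det M = 0.
  rewrite -det_tr; have ne : (lshift m (0 : 'I_1)) != (rshift 1 j) by [].
  apply: (determinant_alternate ne) => i.
  by rewrite !mxE (unsplitK (inl _)) (unsplitK (inr _)) /= mxE.
rewrite -[RHS]M0 (expand_det_col M (lshift m (0 : 'I_1))).
apply: eq_bigr => i _; rewrite !mxE /cofactor mulrC addn0.
rewrite (unsplitK (inl _)) mxE; congr (_ * (_ * _)); congr determinant.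
apply/matrixP => a b; rewrite !mxE.
have -> : lift (lshift m (0 : 'I_1)) b = rshift 1 b by apply: val_inj.
by rewrite (unsplitK (inr _)).
Qed.

Lemma map_signed_minors (A B : comNzRingType) (h : {rmorphism A -> B}) m
    (P : 'M[A]_(m.+1, m)) :
  map_mx h (signed_minors P) = signed_minors (map_mx h P).
Proof.
by apply/rowP => l; rewrite !mxE rmorphM rmorph_sign -map_row' det_map_mx.
Qed.

Lemma ker_row0_eq0 (F : fieldType) m (P : 'M[F]_(m.+1, m)) (v : 'rV[F]_m.+1) :
  \det (row' 0 P) != 0 -> v *m P = 0 -> v 0 0 = 0 -> v = 0.
Proof.
move=> dP vP v0; have H : col' 0 v *m row' 0 P = 0.
  apply/rowP => j; move/rowP/(_ j): vP; rewrite !mxE big_ord_recl v0 mul0r add0r.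
  by move=> E; rewrite -[RHS]E; apply: eq_bigr => i _; rewrite !mxE.
have c0 : col' 0 v = 0.
  have [//|cn] := eqVneq (col' 0 v) 0.
  by case/negP: dP; apply/det0P; exists (col' 0 v).
apply/rowP => i; rewrite mxE; case: (unliftP 0 i) => [j ->|->//].
by move/rowP/(_ j): c0; rewrite !mxE.
Qed.

End SignedMinors.

Section Perturbation.
Variable R : realType.

(** At [e = 0] neighbouring entries of a kernel vector have the nonzero ratio [r l], so the kernel
    is a line and all signed minors are nonzero. Being polynomials in [e], they stay nonzero and
    keep their signs for small [e]. *)
Lemma perturbed_ker m (P : 'M[{poly R}]_(m.+1, m)) (r : 'I_m -> R) :
    (forall l, r l != 0) ->
    (forall v : 'rV[R]_m.+1, v *m map_mx (horner_eval 0) P = 0 ->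
       forall l : 'I_m, v 0 (widen_ord (leqnSn m) l) = r l * v 0 (lift ord0 l)) ->
  exists2 e0 : R, 0 < e0 & forall e, 0 < e -> e < e0 ->
    exists v : 'rV[R]_m.+1,
      [/\ v *m map_mx (horner_eval e) P = 0,
          forall l, v 0 l != 0,
          forall l : 'I_m,
            0 < r l * (v 0 (widen_ord (leqnSn m) l) * v 0 (lift ord0 l))
        & forall w : 'rV[R]_m.+1, w *m map_mx (horner_eval e) P = 0 ->
            exists t, w = t *: v].
Proof.
move=> r0 H.
pose v := signed_minors P.
pose ve e := map_mx (horner_eval e) v.
have veE e l : ve e 0 l = (v 0 l).[e] by rewrite mxE.
have vk e : ve e *m map_mx (horner_eval e) P = 0.
  by rewrite -map_mxM signed_minors_ker map_mx0.
have chain0 (w : 'rV[R]_m.+1) : w *m map_mx (horner_eval 0) P = 0 ->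
    forall l, (w 0 l == 0) = (w 0 0 == 0).
  move=> /H Hw; case; elim=> [|l IH] l1.
    by congr (w 0 _ == 0); apply: val_inj.
  rewrite -(IH (ltnW l1)); have := Hw (Ordinal (l1 : (l < m)%N)).
  have -> : widen_ord (leqnSn m) (Ordinal (l1 : (l < m)%N)) = Ordinal (ltnW l1).
    exact: val_inj.
  have -> : lift ord0 (Ordinal (l1 : (l < m)%N)) = Ordinal l1 by exact: val_inj.
  by move=> ->; rewrite mulf_eq0 (negPf (r0 _)).
(* A kernel vector of the matrix without row 0, extended by 0, has first entry 0 and therefore
   vanishes by [chain0]. *)
have v00 : ve 0 0 0 != 0.
  rewrite /ve map_signed_minors mxE mulf_eq0 signr_eq0 /=.
  apply/negP => /det0P[u /negP un] uP; apply: un.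
  pose w : 'rV[R]_m.+1 := row_mx (0 : 'rV_1) u.
  have w0 : w 0 0 = 0.
    have -> : (0 : 'I_m.+1) = lshift m (0 : 'I_1) by exact: val_inj.
    by rewrite /w mxE (unsplitK (inl _)) mxE.
  have wS j : w 0 (lift ord0 j) = u 0 j.
    have -> : lift ord0 j = rshift 1 j by exact: val_inj.
    by rewrite /w mxE (unsplitK (inr _)).
  have wP : w *m map_mx (horner_eval 0) P = 0.
    apply/rowP => j; move/rowP/(_ j): uP; rewrite !mxE big_ord_recl w0 mul0r add0r.
    by move=> E; rewrite -[RHS]E; apply: eq_bigr => i _; rewrite wS !mxE.
  apply/eqP/rowP => j; rewrite mxE -wS; apply/eqP.
  by rewrite (chain0 _ wP) w0.
have vn l : ve 0 0 l != 0 by rewrite (chain0 _ (vk 0)).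
have [e0 e0p He0] : exists2 e0 : R, 0 < e0 & forall e, 0 < e -> e < e0 ->
    forall l, 0 < ve e 0 l * ve 0 0 l.
  apply: fin_small => l; have := vn l; rewrite veE => /horner_sign_near0.
  by case=> e0 e0p He; exists e0 => // e ep ee0; rewrite !veE; apply: He.
exists e0 => // e ep ee0; exists (ve e).
have sg := He0 e ep ee0.
have ven l : ve e 0 l != 0.
  by apply/eqP => z; have := sg l; rewrite z mul0r ltxx.
split=> // [l|w wP].
  have := H _ (vk 0) l; have := vn (lift ord0 l).
  have := sg (widen_ord (leqnSn m) l); have := sg (lift ord0 l).
  move: (ve e 0 _) (ve e 0 _) (ve 0 0 _) (ve 0 0 _) (r l) (r0 l).
  move=> a b c d rl rl0 bd ac d0 cE.
  have : 0 < (a * c) * (b * d) / (d * d).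
    have sq y : y != 0 -> 0 < y * y :> R by move=> y0; rewrite -expr2 exprn_even_gt0.
    by rewrite divr_gt0 ?sq // mulr_gt0.
  by rewrite cE; congr (0 < _); field.
(* This multiple makes the first entry of the difference zero, which forces the difference to
   vanish. *)
exists (w 0 0 / ve e 0 0); apply/eqP; rewrite -subr_eq0; apply/eqP.
apply: (@ker_row0_eq0 _ _ (map_mx (horner_eval e) P)).
- have := ven 0; rewrite /ve map_signed_minors mxE mulf_eq0 signr_eq0 /=.
  by [].
- by rewrite mulmxBl wP -scalemxAl vk scaler0 subr0.
- by rewrite mxE [X in _ + X]mxE [X in _ - X]mxE divfK ?subrr.
Qed.

End Perturbation.

(** * Alternation of binomial relations *)

Section Alternation.
Variable R : realFieldType.

Lemma mul_bin_affine (t j : nat) (a : R) :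
  'C(t, j)%:R * (t%:R - a) =
  (j.+1)%:R * 'C(t, j.+1)%:R + (j%:R - a) * 'C(t, j)%:R.
Proof.
have -> : j.+1%:R * 'C(t, j.+1)%:R = (t%:R - j%:R) * 'C(t, j)%:R :> R.
  rewrite -natrM mul_bin_left natrM.
  have [jt|tj] := leqP j t; first by rewrite natrB.
  by rewrite bin_small // !mulr0.
ring.
Qed.

(** By [mul_bin_affine], each affine factor raises the lower binomial index by at most one, so the
    products stay in the range of killed moments. *)
Lemma binomial_moments_prod (r : seq nat) (w : nat -> R) (tau : nat -> nat) q m :
    (forall j, (q <= j < m)%N -> \sum_(l <- r) w l * 'C(tau l, j)%:R = 0) ->
  forall (s : seq R) j, (q <= j)%N -> (j + size s < m)%N ->
    \sum_(l <- r) w l * ('C(tau l, j)%:R * \prod_(a <- s) ((tau l)%:R - a)) = 0.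
Proof.
move=> H; elim=> [|a s IH] j qj /= jm.
  under eq_bigr do rewrite big_nil mulr1.
  by rewrite H // qj -(addn0 j).
pose T j' l := w l * ('C(tau l, j')%:R * \prod_(b <- s) ((tau l)%:R - b)).
rewrite (eq_bigr (fun l => j.+1%:R * T j.+1 l + (j%:R - a) * T j l)) => [|l _].
  by rewrite big_split /= -!mulr_sumr !IH ?mulr0 ?addr0 //; lia.
rewrite big_cons [_%:R * (_ * _)]mulrA mul_bin_affine /T; ring.
Qed.

(* The functional [sum_l w_l g(tau_l)] kills [C(t, q) h(t)] for [h] of degree
   below [m - q]; take for [h] the product over all nodes but two neighbours. *)
Lemma binomial_relation_alternates (tau : nat -> nat) q m i :
    {homo tau : a b / (a < b)%N} ->
    (forall l, (q <= l)%N -> (q <= tau l)%N) -> (q <= i < m)%N ->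
  exists2 rho : R, 0 < rho & forall w : nat -> R,
    (forall j, (q <= j < m)%N ->
       \sum_(q <= l < m.+1) w l * 'C(tau l, j)%:R = 0) ->
    w i = - rho * w i.+1.
Proof.
move=> tau_inc tau_ge /andP[qi im].
(* All nodes from [q] to [m] except [tau i] and [tau i.+1]: these [m - q - 1] factors just fit the
   moment condition. *)
pose s : seq R := [seq (tau l)%:R | l <- index_iota q i ++ index_iota i.+2 m.+1].
pose H l : R := 'C(tau l, q)%:R * \prod_(a <- s) ((tau l)%:R - a).
have ltau a b : (a < b)%N -> (tau a)%:R < (tau b)%:R :> R.
  by move=> /tau_inc; rewrite ltr_nat.
(* No node of [s] lies between the two neighbours, so each factor has the same sign at both. *)
have HH : 0 < H i * H i.+1.
  rewrite /H mulrACA; apply: mulr_gt0.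
    by rewrite mulr_gt0 ?ltr0n ?bin_gt0 ?tau_ge // leqW.
  rewrite -big_split big_map big_seq; apply: prodr_gt0 => l.
  rewrite mem_cat !mem_index_iota => /orP[|] /andP[l1 l2].
    by rewrite mulr_gt0 // subr_gt0 ltau //; lia.
  by rewrite nmulr_lgt0 subr_lt0 ltau //; lia.
have A0 : H i != 0 by apply/eqP => z; rewrite z mul0r ltxx in HH.
exists (H i.+1 / H i).
  have : 0 < H i * H i.+1 / (H i * H i).
    by rewrite divr_gt0 // -expr2 exprn_even_gt0.
  by congr (0 < _); field.
move=> w /binomial_moments_prod/(_ s q (leqnn q)).
have -> : (q + size s < m)%N by rewrite size_map size_cat !size_iota; lia.
move=> /(_ isT).
rewrite (big_cat_nat (n := i)) ?(leqW (ltnW im)) //=.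
rewrite (big_ltn (leqW im)) (big_ltn (im : (i.+1 < m.+1)%N)).
have H0 l : l \in index_iota q i ++ index_iota i.+2 m.+1 ->
    \prod_(a <- s) ((tau l)%:R - a) = 0.
  move=> ls; apply/eqP; rewrite prodf_seq_eq0; apply/hasP.
  by exists (tau l)%:R; rewrite ?subrr //=; apply/mapP; exists l.
have zero a b : {subset index_iota a b <= index_iota q i ++ index_iota i.+2 m.+1} ->
    \sum_(a <= l < b) w l * H l = 0.
  by move=> sub; rewrite big_seq big1 // => l /sub ls; rewrite /H H0 ?mulr0.
rewrite [X in X + _]zero => [|l]; last by rewrite mem_cat => ->.
rewrite [X in _ + (_ + (_ + X))]zero => [|l]; last first.
  by rewrite mem_cat orbC => ->.
rewrite add0r addr0 -/(H i) -/(H i.+1) => E.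
have -> : w i = (w i * H i) / H i by rewrite mulfK.
by move/eqP: E; rewrite addr_eq0 => /eqP ->; ring.
Qed.

End Alternation.

(** * Relations between truncated rows *)

Section Relations.
Variable R : realType.

(* Coefficient of [x_j] in [cube_form x i + (-1) ^+ c * e * x_i]. *)
Definition rowc (e : R) (c : bool) (i j : nat) : R :=
  (-1) ^+ i.+1 * ((j < i)%N%:R * 'C(i.-1, j)%:R) + (j == i)%:R * (-1) ^+ c * e.

Definition rowp (c : bool) (i j : nat) : {poly R} :=
  ((-1) ^+ i.+1 * ((j < i)%N%:R * 'C(i.-1, j)%:R))%:P +
  ((j == i)%:R * (-1) ^+ c) *: 'X.

Lemma horner_rowp e c i j : (rowp c i j).[e] = rowc e c i j.
Proof. by rewrite /rowp /rowc hornerD hornerC hornerZ hornerX. Qed.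

Lemma homo_ltn_ge (g : nat -> nat) k : {homo g : a b / (a < b)%N} -> (k <= g k)%N.
Proof.
move=> g_inc; elim: k => // k IH; apply: leq_ltn_trans IH _; exact: g_inc.
Qed.

(** At the first point that is not fixed [p < g p], and strict growth keeps [g] ahead from there on.
    When [g] enumerates an index set, [p] is the length of its initial run. *)
Lemma homo_fixed_prefix (g : nat -> nat) k :
  {homo g : a b / (a < b)%N} -> g k != k ->
  exists p, (p <= k)%N /\ forall l, (g l == l) = (l < p)%N.
Proof.
move=> g_inc gk.
have ex : exists l, g l != l by exists k.
case: (ex_minnP ex) => p gp pmin; exists p; split; first exact: pmin.
move=> l; apply/idP/idP => [/eqP gl|lp]; last first.
  by apply: contraTT lp => /pmin; rewrite -leqNgt.
rewrite ltnNge; apply/negP => pl.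
have gp' : (p < g p)%N by rewrite ltn_neqAle eq_sym gp homo_ltn_ge.
have H d : (p + d < g (p + d)%N)%N.
  elim: d => [|d IH]; first by rewrite addn0.
  by rewrite addnS; apply: leq_ltn_trans IH (g_inc _ _ _).
by have := H (l - p)%N; rewrite subnKC // gl ltnn.
Qed.

Lemma signr_mulK k (x : R) : x * (-1) ^+ k * (-1) ^+ k = x.
Proof. by rewrite -mulrA -expr2 sqrr_sign mulr1. Qed.

Section Scaled.
Variables (m p : nat) (g : nat -> nat) (c : nat -> bool).
Hypothesis g_inc : {homo g : a b / (a < b)%N}.
Hypothesis g_fix : forall l, (g l == l) = (l < p)%N.

(* Row [l] is multiplied by [e ^- (p - l)] and column [j] by [e ^+ (p - j - 1)],
   which makes the matrix regular of corank one at [e = 0]. *)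
Definition scaled_mx : 'M[{poly R}]_(m.+1, m) :=
  \matrix_(l, j) if (l < p)%N then
      if (j < l)%N then ((-1) ^+ l.+1 * 'C(l.-1, j)%:R) *: 'X^(l - j.+1)
      else if j == l :> nat then ((-1) ^+ c l)%:P else 0
    else 'X^(p - j.+1) * rowp (c l) (g l) j.

Lemma g_gt l : (p <= l)%N -> (l < g l)%N.
Proof. by move=> pl; rewrite ltn_neqAle eq_sym g_fix -leqNgt pl homo_ltn_ge.
Qed.

Lemma scaled_mxE e (l : 'I_m.+1) (j : 'I_m) :
  e ^+ (p - l) * (scaled_mx l j).[e] = e ^+ (p - j.+1) * rowc e (c l) (g l) j.
Proof.
rewrite mxE; case: (ltnP l p) => lp; last first.
  by rewrite hornerM hornerXn horner_rowp (eqnP lp) mul1r.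
have := g_fix l; rewrite lp => /eqP gl; rewrite gl /rowc.
case: (ltngtP j l) => jl.
- rewrite hornerZ hornerXn mulrCA -exprD mul0r mul0r addr0 mul1r mulrC.
  by congr (_ ^+ _ * _); lia.
- by rewrite horner0 !mul0r !mulr0 addr0 mulr0.
- rewrite hornerC !mul0r !mulr0 mul1r add0r jl [_ * e]mulrC mulrA -exprSr.
  by congr (_ ^+ _ * _); lia.
Qed.

(** Exponent of the sign of the ratio of entries [l] and [l.+1] of a kernel vector at [e = 0]. Row
    [l] enters with its chosen sign [c l] inside the run and with the sign of its form part beyond
    it; row [l.+1] always enters through its form part. *)
Definition link_sign l : nat := if g l == l then (c l + g l.+1)%N else (g l + g l.+1).+1%N.

Definition vnat (v : 'rV[R]_m.+1) (l : nat) := v 0 (inord l).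

Lemma vnat_ker (v : 'rV[R]_m.+1) : v *m map_mx (horner_eval 0) scaled_mx = 0 ->
  forall j : 'I_m, \sum_(0 <= l < m.+1) vnat v l * (scaled_mx (inord l) j).[0] = 0.
Proof.
move=> /rowP vP j; have := vP j; rewrite mxE [RHS]mxE => H; rewrite -[RHS]H.
by rewrite big_mkord; apply: eq_bigr => l _; rewrite /vnat inord_val [in RHS]mxE.
Qed.

(** At [e = 0] column [l] keeps only the entries of rows [l] and [l.+1]: the later rows carry a
    positive power of [e] because [l.+1 < p]. *)
Lemma link_run (v : 'rV[R]_m.+1) (l : nat) :
    v *m map_mx (horner_eval 0) scaled_mx = 0 -> (l.+1 < p)%N -> (l < m)%N ->
  vnat v l = (-1) ^+ link_sign l * vnat v l.+1.
Proof.
move=> /vnat_ker vP lp lm; have := vP (Ordinal lm).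
have E a : (a <= m)%N -> (scaled_mx (inord a) (Ordinal lm)).[0] =
    (a == l)%:R * (-1) ^+ c l + (a == l.+1)%:R * (-1) ^+ l :> R.
  move=> am; rewrite mxE /= inordK //; case: ltnP => ap.
    case: (ltngtP l a) => la.
    - rewrite mul0r add0r hornerZ hornerXn expr0n.
      case: (eqVneq a l.+1) => [->|al] /=; last first.
        by rewrite (_ : (a - l.+1 == 0)%N = false) ?mulr0 ?mul0r //; lia.
      by rewrite subnn eqxx binn !mulr1 mul1r !exprS !mulN1r opprK.
    - have -> : (a == l.+1) = false by lia.
      by rewrite horner0 !mul0r addr0.
    - have -> : (a == l.+1) = false by lia.
      by rewrite -la hornerC mul1r mul0r addr0.
  have -> : (a == l) = false by lia.
  have -> : (a == l.+1) = false by lia.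
  rewrite hornerM hornerXn expr0n (_ : (p - l.+1 == 0)%N = false) ?mul0r ?addr0 //.
  by lia.
rewrite big_nat; under eq_bigr => a am do rewrite E //.
rewrite -big_nat.
have delta k y : (k <= m)%N ->
    \sum_(0 <= a < m.+1) vnat v a * ((a == k)%:R * y) = vnat v k * y.
  move=> km; rewrite (bigD1_seq k) ?iota_uniq ?mem_index_iota //=.
  by rewrite eqxx mul1r big1 ?addr0 // => a /negPf ->; rewrite mul0r mulr0.
under eq_bigr do rewrite mulrDr.
rewrite big_split /= !delta //; last exact: ltnW.
have -> : link_sign l = (c l + l.+1)%N.
  by rewrite /link_sign g_fix (ltnW lp); have /eqP -> : g l.+1 == l.+1 by rewrite g_fix.
move/eqP; rewrite addr_eq0 => /eqP H.
rewrite -[LHS](signr_mulK (c l)) H exprD exprS.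
ring.
Qed.

(** In the columns from [p.-1] on, only the last row of the run and the rows after it survive at
    [e = 0]. Up to sign their entries are binomials, so the alternation of binomial relations
    applies. *)
Lemma link_tail (l : nat) : (p.-1 <= l)%N -> (l < m)%N ->
  exists2 rho : R, 0 < rho & forall v : 'rV[R]_m.+1,
    v *m map_mx (horner_eval 0) scaled_mx = 0 ->
    vnat v l = rho * (-1) ^+ link_sign l * vnat v l.+1.
Proof.
move=> ql lm; pose q := p.-1.
(* The last row of the run has node [p.-1], because ['C(p.-1, j)] is 1 at [j = p.-1] and 0 in the
   later columns. *)
pose tau a := if (a < p)%N then a else (g a).-1.
have tau_inc : {homo tau : a b / (a < b)%N}.
  move=> a b ab; rewrite /tau; case: (ltnP a p) => ap; case: (ltnP b p) => bp //.
  - by have := g_gt bp; lia.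
  - by lia.
  - by have := g_gt ap; have := g_inc ab; lia.
have tau_ge a : (q <= a)%N -> (q <= tau a)%N.
  by rewrite /tau; case: (ltnP a p) => // ap; have := g_gt ap; lia.
have [|rho rho0 H] := @binomial_relation_alternates R tau q m l tau_inc tau_ge.
  by rewrite ql.
exists rho => // v /vnat_ker vP.
(* The row signs are absorbed into the weights, which leaves a relation between plain binomials. *)
pose sg a : R := if (a < p)%N then (-1) ^+ c a else (-1) ^+ (g a).+1.
have {}H : vnat v l * sg l = - rho * (vnat v l.+1 * sg l.+1).
  apply: (H (fun a => vnat v a * sg a)) => j /andP[qj jm].
  have := vP (Ordinal jm); rewrite (@big_cat_nat _ _ _ q) //=; last by lia.
  rewrite [X in X + _]big_nat big1 ?add0r => [|a aq]; last first.
    rewrite mxE /= inordK; last by lia.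
    have -> : (a < p)%N by lia.
    have -> : (j < a)%N = false by lia.
    have -> : (j == a) = false by lia.
    by rewrite horner0 mulr0.
  move=> E; rewrite -[RHS]E !big_nat; apply: eq_bigr => a aq.
  rewrite -mulrA; congr (_ * _); rewrite mxE /= inordK; last by lia.
  rewrite /sg /tau; case: (ltnP a p) => ap.
    have -> : (j < a)%N = false by lia.
    case: (eqVneq j a) => [->|ja]; first by rewrite binn mulr1 hornerC.
    by rewrite horner0 bin_small ?mulr0 //; lia.
  have -> : (p - j.+1 = 0)%N by lia.
  rewrite expr0 mul1r horner_rowp /rowc mulr0 addr0.
  have ag := g_gt ap; case: ltnP => [jg|gj]; first by rewrite mul1r.
  by rewrite bin_small ?mulr0 //; lia.
have pl : (l.+1 < p)%N = false by lia.
rewrite /sg pl in H; rewrite /link_sign g_fix.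
case: (ltnP l p) H => lp H.
  rewrite -[LHS](signr_mulK (c l)) H exprD exprS.
  ring.
rewrite -[LHS](signr_mulK (g l).+1) H -addSn exprD (exprS _ (g l.+1)).
ring.
Qed.

End Scaled.
End Relations.

Section SmallRelation.
Variable R : realType.

Lemma scaled_link m p g c (l : nat) :
    {homo g : a b / (a < b)%N} -> (forall l, (g l == l) = (l < p)%N) -> (l < m)%N ->
  exists2 rho : R, 0 < rho & forall v : 'rV[R]_m.+1,
    v *m map_mx (horner_eval 0) (scaled_mx R m p g c) = 0 ->
    vnat v l = rho * (-1) ^+ link_sign g c l * vnat v l.+1.
Proof.
move=> g_inc g_fix lm; case: (ltnP l.+1 p) => lp; last first.
  by apply: link_tail => //; lia.
by exists 1 => // v vP; rewrite mul1r; apply: (link_run g_fix vP).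
Qed.

(** Scaling by powers of a positive [e] changes neither the dimension of the relation space nor the
    signs, so the kernel of [scaled_mx] transfers to the rows. The condition at [m.+1] makes the run
    of fixed points end. *)
Lemma small_relation m (g : nat -> nat) (c : nat -> bool) :
    {homo g : a b / (a < b)%N} -> g m.+1 != m.+1 ->
  exists2 e0 : R, 0 < e0 & forall e, 0 < e -> e < e0 -> exists v : nat -> R,
    [/\ forall j, (j < m)%N -> \sum_(l < m.+1) v l * rowc e (c l) (g l) j = 0,
        forall l, (l <= m)%N -> v l != 0,
        forall l, (l < m)%N -> 0 < (-1) ^+ link_sign g c l * (v l * v l.+1)
      & forall w : nat -> R,
          (forall j, (j < m)%N -> \sum_(l < m.+1) w l * rowc e (c l) (g l) j = 0) ->
          exists t, forall l, (l <= m)%N -> w l = t * v l].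
Proof.
move=> g_inc gm; have [p [_ g_fix]] := homo_fixed_prefix g_inc gm.
have /choice[rho Hrho] (l : 'I_m) : exists rho : R, 0 < rho /\ forall v : 'rV[R]_m.+1,
    v *m map_mx (horner_eval 0) (scaled_mx R m p g c) = 0 ->
    vnat v l = rho * (-1) ^+ link_sign g c l * vnat v l.+1.
  by have [rho rho0 H] := scaled_link c g_inc g_fix (ltn_ord l); exists rho.
have inW (l : 'I_m) : inord l = widen_ord (leqnSn m) l.
  by apply: val_inj; rewrite /= inordK // ltnS ltnW.
have inL (l : 'I_m) : inord l.+1 = lift ord0 l.
  by apply: val_inj; rewrite /= inordK // ltnS.
have [l|v vP l|e0 e0p He0] := @perturbed_ker R m (scaled_mx R m p g c)
    (fun l => rho l * (-1) ^+ link_sign g c l).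
- by rewrite mulf_neq0 ?signr_eq0 // gt_eqF //; case: (Hrho l).
- by case: (Hrho l) => _ /(_ v vP); rewrite /vnat inW inL.
exists e0 => // e ep ee0; have [v [vP vn vs vu]] := He0 e ep ee0.
have epn k : e ^+ k != 0 by rewrite expf_neq0 // gt_eqF.
have transfer (u : nat -> R) : (forall j, (j < m)%N ->
      \sum_(l < m.+1) u l * rowc e (c l) (g l) j = 0) <->
    (\row_l (u l * e ^+ (p - l)) *m map_mx (horner_eval e) (scaled_mx R m p g c) = 0).
  have E j : (\row_l (u l * e ^+ (p - l)) *m
      map_mx (horner_eval e) (scaled_mx R m p g c)) 0 j =
      e ^+ (p - j.+1) * \sum_(l < m.+1) u l * rowc e (c l) (g l) j.
    rewrite mxE mulr_sumr; apply: eq_bigr => l _.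
    rewrite mxE [X in _ * X]mxE -mulrA /horner_eval scaled_mxE //.
    by rewrite mulrCA.
  split=> [H|/rowP H j jm]; first by apply/rowP => j; rewrite E H // mulr0 mxE.
  by have /eqP := H (Ordinal jm); rewrite E mxE mulf_eq0 (negPf (epn _)) => /eqP.
pose u l := vnat v l / e ^+ (p - l).
exists u; split.
- apply/(transfer u); rewrite -[RHS]vP; congr (_ *m _); apply/rowP => l.
  by rewrite mxE divfK // /vnat inord_val.
- by move=> l lm; rewrite mulf_neq0 ?invr_eq0 //; apply: vn.
- move=> l lm; have := vs (Ordinal lm); rewrite -inW -inL /= -/(vnat v l) -/(vnat v l.+1).
  rewrite -[rho _ * _ * _]mulrA pmulr_rgt0; last by case: (Hrho (Ordinal lm)).
  by move=> H; rewrite mulrACA -invfM mulrA divr_gt0 // mulr_gt0 // exprn_gt0.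
move=> w /(transfer w)/vu[t wE]; exists t => l lm.
move/rowP/(_ (inord l)): wE; rewrite !mxE inordK // -/(vnat v l) => H.
by rewrite mulrA -H mulfK.
Qed.

End SmallRelation.

(** * Relations supported on an index set *)

Section RelationsOfSets.
Variable R : realType.

Definition prefix_in n (S : {set 'I_n}) (i : 'I_n) : bool :=
  [forall k : 'I_n, (k <= i)%N ==> (k \in S)].

Definition consecutive n (S : {set 'I_n}) (i j : 'I_n) : Prop :=
  [/\ i \in S, j \in S, (i < j)%N & forall k : 'I_n, (i < k < j)%N -> k \notin S].

(* Covers all cases of the criterion: [prefix_in S i] says that the row [i + 1] is
   one of the rows [1, ..., p]. *)
Definition gale_signs n (S : {set 'I_n}) (b : 'I_n -> bool) : Prop :=
  forall i j, consecutive S i j ->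
    if prefix_in S i then b i = odd j else odd (i + j).

(** [b i = true] stands for the sign -1; the first [m] coordinates will be those that the projection
    forgets. *)
Definition relation n m (e : R) (b : 'I_n -> bool) (w : 'I_n -> R) : Prop :=
  forall j, (j < m)%N -> \sum_(i < n) w i * rowc e (b i) i j = 0.

Lemma same_signs m (v : nat -> R) : (forall l, (l <= m)%N -> v l != 0) ->
  (forall l, (l <= m)%N -> 0 < v l / v 0) <->
  (forall l, (l < m)%N -> 0 < v l * v l.+1).
Proof.
move=> vn; have sq l : (l <= m)%N -> 0 < v l * v l.
  by move=> /vn vl; rewrite -expr2 exprn_even_gt0.
split=> H l lm.
  have := mulr_gt0 (mulr_gt0 (H l (ltnW lm)) (H l.+1 lm)) (sq 0 (leq0n m)).
  by congr (0 < _); field; apply: vn.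
elim: l lm => [|l IH] lm; first by rewrite divff ?ltr01 ?vn.
have := divr_gt0 (mulr_gt0 (IH (ltnW lm)) (H l lm)) (sq l (ltnW lm)).
by congr (0 < _); field; rewrite !vn // ltnW.
Qed.

Lemma homo_ltn_mono (g : nat -> nat) a b : {homo g : a b / (a < b)%N} ->
  (g a < g b)%N = (a < b)%N.
Proof.
move=> g_inc; case: (ltngtP a b) => [/g_inc -> // |/g_inc|->]; last by rewrite ltnn.
by case: ltngtP.
Qed.

(** Enumerating [S] increasingly reduces this to [small_relation]; [gale_signs] says that
    [link_sign] is even at every link. *)
Lemma small_relation_set n m (S : {set 'I_n}) (b : 'I_n -> bool) : #|S| = m.+1 ->
  exists2 e0 : R, 0 < e0 & forall e, 0 < e -> e < e0 -> exists lam : 'I_n -> R,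
    [/\ forall i, (lam i != 0) = (i \in S),
        relation m e b lam,
        exists2 i, i \in S & 0 < lam i,
        forall w : 'I_n -> R, (forall i, i \notin S -> w i = 0) ->
          relation m e b w -> exists t, forall i, w i = t * lam i
      & (forall i, i \in S -> 0 < lam i) <-> gale_signs S b].
Proof.
move=> Sm; have [i0 i0S] : exists i0, i0 \in S by apply/card_gt0P; rewrite Sm.
pose f l := nth i0 (enum S) l.
have sz : size (enum S) = m.+1 by rewrite -cardE.
(* Past the last element the values [n + l] keep [g] strictly increasing and prevent [m.+1] from
   being fixed. *)
pose g l := if (l <= m)%N then f l : nat else (n + l)%N.
have srt : sorted ltn (map val (enum S)).
  rewrite -[enum _](eq_filter (mem_enum _)).
  rewrite -(eq_filter (mem_map val_inj _)) -filter_map.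
  by rewrite (sorted_filter ltn_trans) // unlock val_ord_enum iota_ltn_sorted.
have fS l : (l <= m)%N -> f l \in S by move=> lm; rewrite -mem_enum mem_nth ?sz.
have gE l : (l <= m)%N -> g l = f l by rewrite /g => ->.
have g_inc : {homo g : x y / (x < y)%N}.
  move=> x y xy; rewrite /g; case: (leqP y m) => ym; last first.
    by case: ifP => xm; [have := ltn_ord (f x); lia | lia].
  rewrite (leq_trans (ltnW xy) ym).
  have -> k : (k <= m)%N -> f k = nth 0%N (map val (enum S)) k :> nat.
    by move=> km; rewrite (nth_map i0) ?sz.
  - have -> : (f y : nat) = nth 0%N (map val (enum S)) y by rewrite (nth_map i0) ?sz.
    by apply: (sorted_ltn_nth ltn_trans) => //; rewrite inE size_map sz ltnS // ltnW // (leq_trans xy).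
  - by rewrite ltnW // (leq_trans xy).
have g_mono := homo_ltn_mono _ _ g_inc.
have n_gt0 : (0 < n)%N by apply: leq_ltn_trans (ltn_ord i0).
have gm : g m.+1 != m.+1 by rewrite /g ltnn; lia.
have [p [_ g_fix]] := homo_fixed_prefix g_inc gm.
pose c l := b (f l).
have idx i : i \in S -> (index i (enum S) <= m)%N by rewrite -ltnS -sz index_mem mem_enum.
have fidx i : i \in S -> f (index i (enum S)) = i by move=> iS; rewrite /f nth_index ?mem_enum.
have gidx i : i \in S -> g (index i (enum S)) = i by move=> iS; rewrite gE ?idx ?fidx.
have idxf l : (l <= m)%N -> index (f l) (enum S) = l.
  by move=> lm; rewrite index_uniq ?sz ?enum_uniq.
have sumE (u : 'I_n -> R) e j : (forall i, i \notin S -> u i = 0) ->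
    \sum_(i < n) u i * rowc e (b i) i j = \sum_(l < m.+1) u (f l) * rowc e (c l) (g l) j.
  move=> u0; rewrite (bigID [in S]) /= [X in _ + X]big1 => [|i /u0 ->]; last by rewrite mul0r.
  rewrite addr0 -big_enum /= (big_nth i0) sz big_mkord; apply: eq_bigr => l _.
  by rewrite gE // -ltnS.
have link l : (l < m)%N -> odd (link_sign g c l) = false <->
    (if prefix_in S (f l) then b (f l) = odd (f l.+1) else odd (f l + f l.+1)).
  move=> lm; have lm' := ltnW lm.
  (* All indices up to [f l] lie in [S] exactly when the enumeration has skipped none of them. *)
  have -> : prefix_in S (f l) = (g l == l).
    apply/forallP/idP => [H|gl k].
      rewrite g_fix ltnNge; apply/negP => pl.
      have gp : (p < g p)%N by rewrite ltn_neqAle eq_sym g_fix ltnn homo_ltn_ge.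
      have gpl : (g p <= f l)%N by rewrite -gE // leqNgt g_mono -leqNgt.
      have pn : (p < n)%N by have := ltn_ord (f l); lia.
      have := H (Ordinal pn); rewrite /= (leq_trans (ltnW gp) gpl) => /= pS.
      have [kp|pk] := ltnP (index (Ordinal pn) (enum S)) p.
        move: (kp); rewrite -g_fix gE ?idx // fidx //= => /eqP kE.
        by rewrite -kE ltnn in kp.
      have : (g p <= g (index (Ordinal pn) (enum S)))%N by rewrite leqNgt g_mono -leqNgt.
      by rewrite [X in (_ <= X)%N]gE ?idx // fidx //= leqNgt gp.
    apply/implyP; rewrite -gE // (eqP gl) => kl.
    have gk : g k == k by rewrite g_fix (leq_ltn_trans kl) // -g_fix.
    have -> : k = f k by apply: val_inj; rewrite /= -gE ?(eqP gk) // (leq_trans kl).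
    by apply: fS; apply: leq_trans lm'.
  rewrite /link_sign -!gE //; case: ifP => _ /=; last by case: (odd _); split.
  by rewrite oddD oddb /c; case: (b _); case: (odd _); split.
have cons i j : consecutive S i j <->
    exists2 l, (l < m)%N & i = f l /\ j = f l.+1.
  have ltE x y : x \in S -> y \in S ->
      (index x (enum S) < index y (enum S))%N = (x < y)%N.
    by move=> xS yS; rewrite -g_mono !gE ?idx // !fidx.
  split=> [[iS jS ij H]|[l lm [-> ->]]].
    have ab : (index i (enum S) < index j (enum S))%N by rewrite ltE.
    have al : ((index i (enum S)).+1 <= m)%N by apply: leq_trans ab (idx j jS).
    exists (index i (enum S)) => //; rewrite fidx //; split=> //.
    have [<-|ne] := eqVneq (index j (enum S)) (index i (enum S)).+1; first by rewrite fidx.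
    have kS := fS _ al; move: (H (f (index i (enum S)).+1)); rewrite kS.
    rewrite -gE // -(gidx i iS) -(gidx j jS) !g_mono ltnS leqnn /= ltn_neqAle eq_sym ne ab.
    by move=> /(_ isT).
  have lm' := ltnW lm; split; rewrite ?fS //; first by rewrite -!gE // g_mono.
  move=> k; rewrite -!gE //; have [kS|//] := boolP (k \in S).
  by rewrite -(gidx k kS) !g_mono; lia.
have [e0 e0p He0] := small_relation R c g_inc gm.
exists e0 => // e ep ee0; have [v [vr vn vs vu]] := He0 e ep ee0.
(* Division by [v 0] gives the least element of [S] the weight 1, so a common sign of the weights
   means positivity. *)
pose lam i := if i \in S then v (index i (enum S)) / v 0 else 0.
have lamf l : (l <= m)%N -> lam (f l) = v l / v 0.
  by move=> lm; rewrite /lam fS // idxf.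
have lam0 i : i \notin S -> lam i = 0 by rewrite /lam => /negPf ->.
exists lam; split.
- move=> i; rewrite /lam; case: ifP => iS; last by rewrite eqxx.
  by rewrite mulf_neq0 ?invr_eq0 ?vn ?idx.
- move=> j jm; rewrite sumE //.
  rewrite (eq_bigr (fun l : 'I_m.+1 => (v 0)^-1 * (v l * rowc e (c l) (g l) j))).
    by rewrite -mulr_sumr vr ?mulr0.
  by move=> l _; rewrite lamf ?[v l / _]mulrC ?mulrA // -ltnS.
- by exists (f 0); rewrite ?fS // lamf // divff ?ltr01 ?vn.
- move=> w w0 wr; have [|t wt] := vu (w \o f).
    by move=> j jm; rewrite -sumE ?wr.
  exists (t * v 0) => i; have [iS|iS] := boolP (i \in S); last by rewrite w0 // lam0 // mulr0.
  rewrite /lam iS -{1}(fidx i iS) [LHS]wt ?idx //; field; exact: vn.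
- have -> : (forall i, i \in S -> 0 < lam i) <-> (forall l, (l <= m)%N -> 0 < v l / v 0).
    split=> H; first by move=> l lm; rewrite -lamf // H // fS.
    by move=> i iS; rewrite /lam iS H ?idx.
  rewrite (same_signs vn).
  have par l : (l < m)%N -> 0 < v l * v l.+1 <-> odd (link_sign g c l) = false.
    move=> lm; have := vs l lm; rewrite -signr_odd; case: (odd _).
      by rewrite expr1 mulN1r oppr_gt0 => /lt_gtF ->.
    by rewrite expr0 mul1r.
  split=> [H i j /cons[l lm [-> ->]]|H l lm]; first by apply/link => //; apply/par => //; apply: H.
  by apply/par => //; apply/link => //; apply/H/cons; exists l.
Qed.
End RelationsOfSets.

(** * The cube and its faces *)

Section CubeGeometry.
Variables (R : realType) (n : nat) (e : R).
Hypotheses (e_gt0 : 0 < e) (e_le1 : e <= 1).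
Implicit Types (x : 'rV[R]_n) (S : {set 'I_n}) (b : 'I_n -> bool).

Definition rowv x (c : bool) (i : 'I_n) : R := \sum_(j < n) rowc e c i j * x 0 j.

Lemma rowvE x c i : rowv x c i = cube_form x i + (-1) ^+ c * e * x 0 i.
Proof.
rewrite /rowv /cube_form mulr_sumr [X in _ = X + _]big_mkcond /=.
rewrite (eq_bigr (fun j : 'I_n => (if (j < i)%N then
    (-1) ^+ i.+1 * ('C(i.-1, j)%:R * x 0 j) else 0) +
    (if j == i then (-1) ^+ c * e * x 0 j else 0))) => [|j _].
  by rewrite big_split /=; congr (_ + _); rewrite -big_mkcond big_pred1_eq.
rewrite /rowc -val_eqE; case: ltngtP => ji; rewrite ?mul1r ?mul0r ?mulr0; ring.
Qed.

Lemma rowvD x y t c i : rowv (x + t *: y) c i = rowv x c i + t * rowv y c i.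
Proof.
rewrite /rowv mulr_sumr -big_split; apply: eq_bigr => j _; rewrite !mxE /=; ring.
Qed.

Lemma cubeP x : cube e x <-> forall i c, rowv x c i <= cube_bound e i.
Proof.
split=> H i => [c|].
  apply: le_trans (H i); rewrite rowvE lerD2l -mulrA.
  apply: le_trans (ler_norm _) _.
  by rewrite normrMsign normrM (gtr0_norm e_gt0).
have [x0|x0] := leP 0 (x 0 i).
  by have := H i false; rewrite rowvE expr0 mul1r ger0_norm.
by have := H i true; rewrite rowvE expr1 mulN1r ltr0_norm // mulrN mulNr.
Qed.

Lemma cube_bound_gt0 (i : 'I_n) : 0 < cube_bound e i.
Proof. by rewrite divr_gt0 // exprn_gt0. Qed.

Lemma sum_bin_prefix (i : 'I_n) : (0 < i)%N ->
  \sum_(j < n | (j < i)%N) 'C(i.-1, j)%:R = 2 ^+ i.-1 :> R.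
Proof.
move=> i0; have := big_ord_widen _ (fun j => 'C(i.-1, j)%:R : R) (ltnW (ltn_ord i)).
move=> <-; rewrite -(prednK i0) /= -[2]/(1 + 1) exprDn.
by apply: eq_bigr => j _; rewrite !expr1n mulr1.
Qed.

(** By induction the earlier forms are below their bounds, so the earlier inequalities give
    [|x_j| < 2 * cube_bound e j / e]. Weighted with the binomials, these estimates add up to at most
    [cube_bound e i]. *)
Lemma cube_form_lt x (i : 'I_n) :
  (forall j : 'I_n, (j < i)%N -> cube_form x j + e * `|x 0 j| <= cube_bound e j) ->
  `|cube_form x i| < cube_bound e i.
Proof.
have [k] := ubnP (i : nat); elim: k i => // k IH i; rewrite ltnS => ik Hx.
have [i0|i0] := posnP i.
  rewrite /cube_form big_pred0 => [|j]; last by rewrite i0.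
  by rewrite mulr0 normr0 cube_bound_gt0.
have xj (j : 'I_n) : (j < i)%N -> `|x 0 j| < 2 ^+ 'C(i, 2) * 2 / e ^+ i.
  move=> ji; have := Hx j ji.
  have : `|cube_form x j| < cube_bound e j.
    by apply: IH => [|l lj]; [apply: leq_trans ik | apply: Hx; apply: ltn_trans ji].
  rewrite ltr_norml => /andP[f1 _] H.
  have : `|x 0 j| < 2 * cube_bound e j / e by rewrite ltr_pdivlMr // mulrC; lra.
  move/lt_le_trans; apply.
  rewrite /cube_bound mulrA [_ * 2]mulrC -!mulrA ler_pM2l // -invfM -exprSr.
  have ei l : 0 <= e ^+ l by rewrite exprn_ge0 // ltW.
  apply: ler_pM => //; first by rewrite exprn_ge0.
  - by rewrite invr_ge0.
  - by rewrite ler_eXn2l ?ltr1n // leq_bin2l.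
  - by rewrite lef_pV2 ?posrE ?exprn_gt0 // ler_wiXn2l // ltW.
rewrite /cube_form normrM normrX normrN1 expr1n mul1r.
apply: le_lt_trans (ler_norm_sum _ _ _) _.
(* The binomials sum to [2 ^+ i.-1], and ['C(i, 2) + 1 + i.-1 = 'C(i.+1, 2)]. *)
have -> : cube_bound e i = \sum_(j < n | (j < i)%N) 'C(i.-1, j)%:R * (2 ^+ 'C(i, 2) * 2 / e ^+ i).
  rewrite -mulr_suml sum_bin_prefix // /cube_bound binS bin1 exprD.
  by rewrite -{2}(prednK i0) exprS; ring.
apply: ltr_sum => [|j ji].
  by apply/hasP; exists (Ordinal (leq_ltn_trans (leq0n i) (ltn_ord i))); rewrite ?mem_index_enum.
rewrite normrM ger0_norm // ltr_pM2l ?xj // ltr0n bin_gt0; lia.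
Qed.

(** [y i] prescribes the position between the two opposite inequalities of index [i], with 1 and -1
    making one of them tight. The system is triangular and is solved one coordinate at a time. *)
Lemma cube_point (y : 'I_n -> R) : (forall i, `|y i| <= 1) ->
  exists x, cube e x /\ forall i, e * x 0 i = y i * (cube_bound e i - cube_form x i).
Proof.
move=> y1; have /(_ n)[x Hx] k : exists x, forall i : 'I_n, (i < k)%N ->
    e * x 0 i = y i * (cube_bound e i - cube_form x i).
  elim: k => [|k [x IH]]; first by exists 0.
  (* Forms of index at most [k] use only coordinates before [k], so resetting coordinate [k] keeps
     the earlier equations. *)
  exists (\row_i if i == k :> nat then y i * (cube_bound e i - cube_form x i) / e
          else x 0 i) => i; rewrite ltnS => ik.
  set x' := \row_i _.
  have -> : cube_form x' i = cube_form x i.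
    congr (_ * _); apply: eq_bigr => j ji; rewrite mxE.
    by have -> : (j == k :> nat) = false by lia.
  rewrite mxE; case: eqVneq => [_|ne]; first by field; rewrite gt_eqF.
  by apply: IH; rewrite ltn_neqAle ne.
exists x; split=> [i|i]; last exact: Hx.
have [k] := ubnP (i : nat); elim: k i => // k IH i; rewrite ltnS => ik.
have : `|cube_form x i| < cube_bound e i.
  by apply: cube_form_lt => j ji; apply: IH; apply: leq_trans ik.
rewrite ltr_norml => /andP[_ f2].
rewrite -[e in e * _](gtr0_norm e_gt0) -normrM Hx // normrM -lerBrDl.
by rewrite (gtr0_norm (_ : 0 < cube_bound e i - cube_form x i)) ?subr_gt0 // ler_piMl // subr_ge0 ltW.
Qed.

(** Counterpart of [cube_face] for a set of tight indices and a sign function, where [true] means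
    -1. *)
Definition sface S b : set 'rV[R]_n :=
  [set x | cube e x /\ forall i, i \in S -> rowv x (b i) i = cube_bound e i].

(** Take [y] to be the prescribed sign on [S] and 0 elsewhere: this is a relative interior point,
    where no other inequality is tight. *)
Lemma sface_interior S b : exists x, sface S b x /\
  forall i c, ~~ ((i \in S) && (c == b i)) -> rowv x c i < cube_bound e i.
Proof.
have [i|x [xc Hx]] := @cube_point (fun i => (i \in S)%:R * (-1) ^+ b i).
  by case: (i \in S); rewrite ?mul1r ?mul0r ?normr0 // normrX normrN1 expr1n.
have f_lt i : 0 < cube_bound e i - cube_form x i.
  have : `|cube_form x i| < cube_bound e i by apply: cube_form_lt => j _; apply: xc.
  by rewrite ltr_norml subr_gt0 => /andP[].
have rE i c : rowv x c i = cube_form x i +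
    (-1) ^+ c * ((i \in S)%:R * (-1) ^+ b i) * (cube_bound e i - cube_form x i).
  by rewrite rowvE -mulrA Hx !mulrA.
exists x; split; first split=> // i iS.
  by rewrite rE iS mul1r -expr2 sqrr_sign; ring.
move=> i c; rewrite rE; case: (i \in S) => /= cb.
  have -> : (-1) ^+ c * (1%:R * (-1) ^+ b i) = -1 :> R.
    by rewrite mul1r; case: c (b i) cb => [] [] //= _; rewrite ?expr0 ?expr1 ?mulr1 ?mul1r.
  by have := f_lt i; lra.
by rewrite mul0r mulr0 mul0r addr0 -subr_gt0.
Qed.

(** The tight rows are constant along [v], and the finitely many other inequalities have slack at
    [x]. *)
Lemma sface_perturb S b x v : sface S b x ->
    (forall i c, ~~ ((i \in S) && (c == b i)) -> rowv x c i < cube_bound e i) ->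
    (forall i, i \in S -> rowv v (b i) i = 0) ->
  exists2 t : R, 0 < t & sface S b (x + t *: v).
Proof.
move=> [xc xS] xlt vS.
have [t0 t0p Ht] : exists2 t0 : R, 0 < t0 & forall t, 0 < t -> t < t0 ->
    forall ic : 'I_n * bool, rowv x ic.2 ic.1 + t * rowv v ic.2 ic.1 <= cube_bound e ic.1.
  apply: fin_small => -[i c] /=; have [/andP[iS /eqP ->]|/xlt lt] := boolP ((i \in S) && (c == b i)).
    by exists 1 => // t _ _; rewrite vS // mulr0 addr0 xS.
  have v0 : 0 < `|rowv v c i| + 1 by rewrite ltr_wpDl.
  exists ((cube_bound e i - rowv x c i) / (`|rowv v c i| + 1)).
    by rewrite divr_gt0 ?subr_gt0.
  move=> t t0; rewrite ltr_pdivlMr // => H.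
  have : t * rowv v c i <= t * (`|rowv v c i| + 1).
    by rewrite ler_pM2l // (le_trans (ler_norm _)) // lerDl.
  by lra.
have t2 : 0 < t0 / 2 by rewrite divr_gt0.
exists (t0 / 2) => //; split.
  apply/cubeP => i c; rewrite rowvD; apply: (Ht _ _ _ (i, c)) => //.
  by lra.
by move=> i iS; rewrite rowvD vS // mulr0 addr0 xS.
Qed.

(** Elimination from the last coordinate down: the sign of the coefficient at [k] selects one of the
    two rows, its absolute value over [e] is the weight, and subtraction leaves a functional of the
    first [k] coordinates. *)
Lemma functional_decomposition (c : 'I_n -> R) : exists (lam : 'I_n -> R) (b : 'I_n -> bool),
  (forall i, 0 <= lam i) /\ forall j : 'I_n, \sum_(i < n) lam i * rowc e (b i) i j = c j.
Proof.
clear e_le1.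
suff H k : forall c : 'I_n -> R, (forall j : 'I_n, (k <= j)%N -> c j = 0) ->
    exists (lam : 'I_n -> R) (b : 'I_n -> bool),
    [/\ forall i, 0 <= lam i, forall i : 'I_n, (k <= i)%N -> lam i = 0
      & forall j : 'I_n, \sum_(i < n) lam i * rowc e (b i) i j = c j].
  have [j|lam [b [lam0 _ Hlam]]] := H n c; first by rewrite leqNgt ltn_ord.
  by exists lam, b.
elim: k => [|k IH] {}c c0.
  exists (fun=> 0), (fun=> false); split=> // j.
  by rewrite c0 // big1 // => i _; rewrite mul0r.
have [kn|nk] := ltnP k n; last first.
  have [j kj|lam [b [lam0 lamk Hlam]]] := IH c; first by have := ltn_ord j; lia.
  by exists lam, b; split=> // i ki; apply: lamk; apply: ltnW.
pose kk := Ordinal kn; pose bk := c kk < 0; pose lk := `|c kk| / e.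
have [j kj|lam [b [lam0 lamk Hlam]]] := IH (fun j => c j - lk * rowc e bk k j).
  rewrite /rowc [(j < k)%N]ltnNge kj /= mul0r mulr0 add0r.
  case: (eqVneq (j : nat) k) => [jk|ne].
    have -> : j = kk by apply: val_inj.
    rewrite mul1r [_ * e]mulrC mulrA divfK ?gt_eqF // mulrC /bk.
    by case: ltrP => ck; rewrite ?(ltr0_norm ck) ?(ger0_norm ck); ring.
  by rewrite c0 ?mul0r ?mulr0 ?subr0 // ltn_neqAle eq_sym ne.
exists (fun i => if i == kk then lk else lam i), (fun i => if i == kk then bk else b i).
split=> [i|i ki|j].
- by case: ifP => // _; rewrite divr_ge0 // ltW.
- by rewrite -val_eqE /= gtn_eqF // lamk // ltnW.
- rewrite (bigD1 kk) //= eqxx; have := Hlam j; rewrite (bigD1 kk) //= lamk // mul0r add0r.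
  rewrite (eq_bigr (fun i : 'I_n => (if i == kk then lk else lam i) *
     rowc e (if i == kk then bk else b i) i j)) => [->|i /negPf ->//]; ring.
Qed.

(** Coefficients vanish one by one from the last row: column [i] involves only later rows and row
    [i], whose entry there is [e] up to sign. *)
Lemma rows_independent (r : 'I_n -> R) b :
  (forall j : 'I_n, \sum_(i < n) r i * rowc e (b i) i j = 0) -> forall i, r i = 0.
Proof.
clear e_le1.
move=> H i; have [k] := ubnP (n - i)%N; elim: k i => // k IH i ik.
have := H i; rewrite (bigD1 i) //= big1 => [|j ji].
  rewrite addr0 /rowc ltnn mul0r mulr0 add0r eqxx mul1r => /eqP.
  by rewrite !mulf_eq0 signr_eq0 (gt_eqF e_gt0) !orbF => /eqP.
rewrite /rowc [(i == j :> nat)]eq_sym val_eqE (negPf ji) mul0r mul0r addr0.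
case: ltnP => ij; last by rewrite mul0r !mulr0.
by rewrite IH ?mul0r //; have := ltn_ord j; lia.
Qed.

Lemma weighted_rows_le (lam : 'I_n -> R) b x : (forall i, 0 <= lam i) -> cube e x ->
  \sum_(i < n) lam i * rowv x (b i) i <= \sum_(i < n) lam i * cube_bound e i.
Proof. by move=> l0 /cubeP xc; apply: ler_sum => i _; rewrite ler_wpM2l. Qed.

(** Complementary slackness: equality of the weighted sums forces equality in each row of nonzero
    weight. *)
Lemma weighted_rows_eq (lam : 'I_n -> R) b x : (forall i, 0 <= lam i) -> cube e x ->
  \sum_(i < n) lam i * rowv x (b i) i = \sum_(i < n) lam i * cube_bound e i <->
  sface [set i | lam i != 0] b x.
Proof.
move=> l0 xc; split=> [/eqP|[_ H]].
  rewrite eq_sym -subr_eq0 -sumrB psumr_eq0 => [/allP H|i _]; last first.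
    by rewrite subr_ge0 ler_wpM2l //; move/cubeP: xc; apply.
  split=> // i; rewrite inE => li; have := H i (mem_index_enum _).
  by rewrite -mulrBr mulf_eq0 (negPf li) subr_eq0 => /eqP.
apply: eq_bigr => i _; have [->|li] := eqVneq (lam i) 0; first by rewrite !mul0r.
by rewrite H ?inE.
Qed.

End CubeGeometry.

(** * Facets of the projected cube *)

Section Generic.
Variable R : realType.

(** Isolates what the smallness of [e] provides. Finite functions as signs leave finitely many
    pairs, as [fin_small] requires. *)
Definition generic n m (e : R) : Prop :=
  forall (S : {set 'I_n}) (b : {ffun 'I_n -> bool}), #|S| = m.+1 ->
  exists lam : 'I_n -> R,
    [/\ forall i, (lam i != 0) = (i \in S),
        relation m e b lam,
        exists2 i, i \in S & 0 < lam i,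
        forall w : 'I_n -> R, (forall i, i \notin S -> w i = 0) ->
          relation m e b w -> exists t, forall i, w i = t * lam i
      & (forall i, i \in S -> 0 < lam i) <-> gale_signs S b].

Lemma small_generic n m : exists2 e0 : R, 0 < e0 &
  forall e, 0 < e -> e < e0 -> generic n m e.
Proof.
have [[S b]|e0 e0p H] := @fin_small R ({set 'I_n} * {ffun 'I_n -> bool})%type
  (fun Sb e => #|Sb.1| = m.+1 -> exists lam : 'I_n -> R,
    [/\ forall i, (lam i != 0) = (i \in Sb.1),
        relation m e Sb.2 lam,
        exists2 i, i \in Sb.1 & 0 < lam i,
        forall w : 'I_n -> R, (forall i, i \notin Sb.1 -> w i = 0) ->
          relation m e Sb.2 w -> exists t, forall i, w i = t * lam i
      & (forall i, i \in Sb.1 -> 0 < lam i) <-> gale_signs Sb.1 Sb.2]).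
  have [Sm|ne] := eqVneq #|S| m.+1.
    have [e0 e0p H] := small_relation_set R b Sm.
    by exists e0 => // e ep ee0 _; apply: H.
  by exists 1 => // e _ _ /= Sm; rewrite Sm eqxx in ne.
by exists e0 => // e ep ee0 S b; apply: (H e ep ee0 (S, b)).
Qed.

Lemma set_between (T : finType) (A B : {set T}) k : A \subset B ->
  (#|A| <= k <= #|B|)%N -> exists C : {set T}, [/\ A \subset C, C \subset B & #|C| = k].
Proof.
move=> AB /andP[Ak kB]; elim: k Ak kB => [|k IH] Ak kB.
  by exists A; split=> //; apply/eqP; rewrite -leqn0.
have [E|ne] := eqVneq #|A| k.+1; first by exists A.
have [|C [AC CB Ck]] := IH _ (ltnW kB); first by rewrite -ltnS ltn_neqAle ne.
have : C \proper B by rewrite properEcard CB Ck.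
case/properP=> _ [x xB xC]; exists (x |: C); split.
- exact: fintype.subset_trans AC (finset.subsetUr _ _).
- by rewrite finset.subUset finset.sub1set xB.
- by rewrite cardsU1 xC Ck.
Qed.

Lemma has_affdim_uniq d (A : set 'rV[R]_d) k l : has_affdim A k -> has_affdim A l -> k = l.
Proof.
move=> [_ [V [Vd Vmin <-]]] [_ [W [Wd Wmin <-]]].
by apply/eqP; rewrite eqn_leq !dimvS // ?Vmin ?Wmin.
Qed.

Section Hyperplane.
Variable d : nat.
Implicit Types c : 'cV[R]_d.

Definition hyperplane c : {vspace 'rV[R]_d} := lker (linfun (mulmxr c : 'rV[R]_d -> 'rV[R]_1)).

Lemma mem_hyperplane c v : (v \in hyperplane c) = ((v *m c) 0 0 == 0).
Proof.
rewrite memv_ker lfunE /=; apply/eqP/eqP => [->|H]; first by rewrite mxE.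
by apply/matrixP => i j; rewrite !ord1 H mxE.
Qed.

Lemma dim_hyperplane c : c != 0 -> (\dim (hyperplane c)).+1 = d.
Proof.
move=> c0; pose f := linfun (mulmxr c : 'rV[R]_d -> 'rV[R]_1).
have := limg_ker_dim f fullv; rewrite capfv dimvf /dim /= mul1n => E.
suff f1 : \dim (limg f) = 1%N by move: E; rewrite f1 addn1.
apply/eqP; rewrite eqn_leq; apply/andP; split.
  by apply: leq_trans (dimvS (subvf _)) _; rewrite dimvf /dim /= muln1.
rewrite lt0n dimv_eq0; apply: contraNneq c0 => f0.
apply/eqP/colP => i; rewrite [RHS]mxE.
have : f (delta_mx 0 i) \in limg f by rewrite memv_img ?memvf.
rewrite f0 memv0 lfunE /= => /eqP/matrixP/(_ 0 0).
by rewrite -rowE !mxE.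
Qed.

Lemma hyperplane_sub c c1 : c != 0 -> (hyperplane c <= hyperplane c1)%VS ->
  exists t, c1 = t *: c.
Proof.
move=> c0 sub; have [i ci] : exists i, c i 0 != 0.
  apply/existsP; apply: contraNT c0; rewrite negb_exists => /forallP H.
  by apply/eqP/colP => i; rewrite mxE; have := H i; rewrite negbK => /eqP.
exists (c1 i 0 / c i 0); apply/colP => j; rewrite mxE.
(* These test vectors lie in the kernel of [c]; evaluating [c1] on them gives proportionality. *)
have ev c' : ((c i 0 *: delta_mx 0 j - c j 0 *: delta_mx 0 i : 'rV_d) *m c') 0 0 =
    c i 0 * c' j 0 - c j 0 * c' i 0.
  by rewrite mulmxBl -!scalemxAl -!rowE !mxE.
have /(subvP sub) : (c i 0 *: delta_mx 0 j - c j 0 *: delta_mx 0 i : 'rV_d) \in hyperplane c.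
  by rewrite mem_hyperplane ev mulrC subrr.
rewrite mem_hyperplane ev subr_eq0 => /eqP E.
by rewrite mulrAC -[LHS](mulfK ci) [c1 j 0 * _]mulrC E [c j 0 * _]mulrC.
Qed.

End Hyperplane.
End Generic.

(** * Facets as positive relations between truncated rows *)

Section ProjectedCube.
Variables (R : realType) (n d : nat) (dn : (d <= n)%N) (e : R).
Hypotheses (d_gt0 : (0 < d)%N) (e_gt0 : 0 < e) (e_le1 : e <= 1).
Let m := (n - d)%N.
Hypothesis gen : generic n m e.
Implicit Types (S : {set 'I_n}) (b : 'I_n -> bool) (c : 'cV[R]_d).

Definition pidx (j : 'I_d) : 'I_n := cast_ord (subnK dn) (rshift (n - d) j).

Lemma projE (x : 'rV[R]_n) j : proj dn x 0 j = x 0 (pidx j).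
Proof. by rewrite mxE. Qed.

Lemma sum_pidx (F : 'I_n -> R) : (forall j : 'I_n, (j < m)%N -> F j = 0) ->
  \sum_(j < n) F j = \sum_(j < d) F (pidx j).
Proof.
move=> F0; rewrite (reindex (cast_ord (subnK dn))) /=; last first.
  by exists (cast_ord (esym (subnK dn))) => i _; rewrite ?cast_ordK ?cast_ordKV.
by rewrite big_split_ord /= big1 ?add0r // => i _; apply: F0 => /=.
Qed.

Lemma pidx_ge (i : 'I_n) : (m <= i)%N -> exists j, i = pidx j.
Proof.
move=> mi; have jd : (i - m < d)%N by have := ltn_ord i; rewrite /m; lia.
by exists (Ordinal jd); apply: val_inj => /=; rewrite subnKC.
Qed.

Lemma proj_surj (y : 'rV[R]_d) : exists2 x : 'rV[R]_n, proj dn x = y &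
  forall j : 'I_n, (j < m)%N -> x 0 j = 0.
Proof.
exists (\row_i \sum_(j < d | pidx j == i) y 0 j).
  apply/rowP => j; rewrite projE mxE (big_pred1 j) // => k.
  by rewrite /= -!val_eqE /= eqn_add2l.
move=> i im; rewrite mxE big_pred0 // => j; rewrite -val_eqE /=.
by apply/negbTE; rewrite neq_ltn orbC (leq_trans im) ?leq_addr.
Qed.

(** For a relation [lam] the weighted sum of rows factors through the projection; this is the
    induced functional. *)
Definition normal (lam : 'I_n -> R) b : 'cV[R]_d :=
  \col_j \sum_(i < n) lam i * rowc e (b i) i (pidx j).

Lemma sum_rows (lam : 'I_n -> R) b x :
  \sum_(i < n) lam i * rowv e x (b i) i =
  \sum_(j < n) (\sum_(i < n) lam i * rowc e (b i) i j) * x 0 j.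
Proof.
under eq_bigr do rewrite mulr_sumr; rewrite exchange_big; apply: eq_bigr => j _.
by rewrite mulr_suml; apply: eq_bigr => i _; rewrite mulrA.
Qed.

Lemma normalE (lam : 'I_n -> R) b x : relation m e b lam ->
  (proj dn x *m normal lam b) 0 0 = \sum_(i < n) lam i * rowv e x (b i) i.
Proof.
move=> rel; rewrite sum_rows sum_pidx => [|j jm]; last by rewrite rel ?mul0r.
by rewrite mxE; apply: eq_bigr => j _; rewrite projE mulrC mxE.
Qed.

(** Extend [c] by zero to the forgotten coordinates and decompose it into rows of the cube. *)
Lemma normal_exists c : exists (lam : 'I_n -> R) (b : {ffun 'I_n -> bool}),
  [/\ forall i, 0 <= lam i, relation m e b lam & normal lam b = c].
Proof.
have [lam [b [l0 H]]] := functional_decomposition e_gt0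
  (fun i => \sum_(j < d | pidx j == i) c j 0).
exists lam, [ffun i => b i]; split=> // [j jm|].
  have jn : (j < n)%N by rewrite (leq_trans jm) // leq_subr.
  have := H (Ordinal jn); rewrite [RHS]big_pred0 => [E|k]; last first.
    by rewrite -val_eqE /=; apply/negbTE; rewrite neq_ltn orbC (leq_trans jm) ?leq_addr.
  by rewrite -[RHS]E; apply: eq_bigr => i _; rewrite ffunE.
apply/colP => j; rewrite mxE; under eq_bigr do rewrite ffunE.
by rewrite H (big_pred1 j) // => k; rewrite /= -!val_eqE /= eqn_add2l.
Qed.

Lemma normal_inj0 (lam : 'I_n -> R) b : relation m e b lam -> normal lam b = 0 ->
  forall i, lam i = 0.
Proof.
move=> rel /colP N; apply: (rows_independent e_gt0 (b := b)) => j.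
have [jm|/pidx_ge[k ->]] := ltnP j m; first exact: rel.
by have := N k; rewrite !mxE.
Qed.

(** A small move along [v] from a relative interior point stays in the face, so a multiple of
    [proj dn v] is a difference of two projected points. *)
Lemma proj_sface_dir S b (W : {vspace 'rV[R]_d}) (v : 'rV[R]_n) :
    (forall y y', (proj dn @` sface e S b) y -> (proj dn @` sface e S b) y' -> y - y' \in W) ->
    (forall i, i \in S -> rowv e v (b i) i = 0) ->
  proj dn v \in W.
Proof.
move=> HW vS; have [x [xS xlt]] := sface_interior e_gt0 e_le1 S b.
have [t t0 xt] := sface_perturb e_gt0 xS xlt vS.
have : proj dn (x + t *: v) - proj dn x \in W by apply: HW; [exists (x + t *: v) | exists x].
have -> : proj dn (x + t *: v) - proj dn x = t *: proj dn v.
  by apply/rowP => j; rewrite !mxE addrC addKr.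
by move/(memvZ t^-1); rewrite scalerA mulVf ?scale1r // gt_eqF.
Qed.

Lemma sface0 b : sface e finset.set0 b = @cube R n e.
Proof. by apply/seteqP; split=> x; [case | split=> // i; rewrite inE]. Qed.

Lemma has_affdim_ncp : has_affdim (@ncp R n d dn e) d.
Proof.
rewrite /ncp -(sface0 (fun=> false)); split.
  have [x [xS _]] := sface_interior e_gt0 e_le1 (finset.set0 : {set 'I_n}) (fun=> false).
  by exists (proj dn x); exists x.
exists fullv; split=> [x y _ _|W HW|]; [exact: memvf | | by rewrite dimvf /dim /= mul1n].
apply/subvP => y _; have [x <- _] := proj_surj y.
by apply: proj_sface_dir HW _ => i; rewrite inE.
Qed.

Lemma proj_sface_eq (lam : 'I_n -> R) b : (forall i, 0 <= lam i) -> relation m e b lam ->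
  let B := \sum_(i < n) lam i * cube_bound e i in
  forall x, cube e x ->
  ((proj dn x *m normal lam b) 0 0 <= B) /\
  ((proj dn x *m normal lam b) 0 0 = B <-> sface e [set i | lam i != 0]%SET b x).
Proof.
move=> l0 rel B x xc; rewrite normalE //; split; first exact: weighted_rows_le.
exact: weighted_rows_eq.
Qed.

(** A lift of [y] is corrected in the forgotten coordinates until the rows in [S] vanish. The
    obstructions are the relations on [S], all multiples of [lam], and they vanish since [y] is
    killed by the normal. *)
Lemma row_kernel_lift S b (lam : 'I_n -> R) (y : 'rV[R]_d) :
    (forall w : 'I_n -> R, (forall i, i \notin S -> w i = 0) ->
       relation m e b w -> exists t, forall i, w i = t * lam i) ->
    relation m e b lam ->
    (y *m normal lam b) 0 0 = 0 ->
  exists2 v, proj dn v = y & forall i, i \in S -> rowv e v (b i) i = 0.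
Proof.
move=> uniq rel yc; have [x xy x0] := proj_surj y.
(* [A] holds the truncated rows in [S] and [u] their values at the lift; the correction exists once
   [u] is in the column space of [A]. *)
pose A : 'M[R]_(n, m) := \matrix_(i, j) ((i \in S)%:R * rowc e (b i) i j).
pose u : 'cV[R]_n := \col_i ((i \in S)%:R * rowv e x (b i) i).
have : (u^T <= A^T)%MS.
  rewrite submxE; have := mulmx_coker A^T; move: (cokermx A^T) => K AK.
  apply/eqP/rowP => k; rewrite [RHS]mxE; pose w i := (i \in S)%:R * K i k.
  have [i iS|j jm|t wt] := uniq w.
  - by rewrite /w (negPf iS) mul0r.
  - move/matrixP/(_ (Ordinal jm) k): AK; rewrite [RHS]mxE => E.
    rewrite -[RHS]E mxE; apply: eq_bigr => i _; rewrite !mxE /w /=; ring.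
  rewrite mxE (eq_bigr (fun i => t * (lam i * rowv e x (b i) i))) => [|i _].
    by rewrite -mulr_sumr -normalE // xy yc mulr0.
  by rewrite [t * _]mulrA -wt !mxE /w; ring.
case/submxP => D uD.
pose z : 'rV[R]_n := \row_i \sum_(j < m | j == i :> nat) D 0 j.
exists (x - z) => [|i iS].
  rewrite -xy; apply/rowP => j; rewrite !projE !mxE big_pred0 ?subr0 // => k.
  by apply/negbTE; rewrite neq_ltn /= ltn_addr.
have -> : x - z = x + (-1) *: z by rewrite scaleN1r.
rewrite rowvD mulN1r; apply/eqP; rewrite subr_eq0; apply/eqP.
move/rowP/(_ i): uD; rewrite !mxE iS mul1r => ->.
rewrite /rowv; under [RHS]eq_bigr do rewrite mxE mulr_sumr.
rewrite (exchange_big_dep predT) //=; apply: eq_bigr => j _.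
have jn : (j < n)%N by rewrite (leq_trans (ltn_ord j)) // leq_subr.
rewrite (big_pred1 (Ordinal jn)) => [|k]; last by rewrite /= -[in RHS]val_eqE /= eq_sym.
by rewrite !mxE iS mul1r mulrC.
Qed.

(** The positive relation yields a supporting functional whose face is the projected one. By
    uniqueness of the relation, every vector of its kernel lifts to a direction of the face, so the
    dimension is [d.-1]. *)
Lemma facet_of_gale S (b : {ffun 'I_n -> bool}) : #|S| = m.+1 -> gale_signs S b ->
  facet (ncp dn e) (proj dn @` sface e S b).
Proof.
move=> Sm gS; have [lam [supp rel _ uniq /iffRL/(_ gS) lam_pos]] := gen b Sm.
have SE : [set i | lam i != 0]%SET = S by apply/finset.setP => i; rewrite inE supp.
have lam_ge i : 0 <= lam i.
  have [/lam_pos/ltW //|iS] := boolP (i \in S).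
  by rewrite (_ : lam i = 0) //; apply/eqP; rewrite -[_ == _]negbK supp.
have := proj_sface_eq lam_ge rel; rewrite SE /=; set B := \sum_(i < n) _ => HB.
have [x0 [x0S _]] := sface_interior e_gt0 e_le1 S b.
have B_gt0 : 0 < B.
  have [i iS] : exists i, i \in S by apply/card_gt0P; rewrite Sm.
  rewrite /B (bigD1 i) //= ltr_wpDr //; last by rewrite mulr_gt0 ?cube_bound_gt0 ?lam_pos.
  by apply: sumr_ge0 => k _; rewrite mulr_ge0 // ltW ?cube_bound_gt0.
(* A zero normal would give the positive maximum [B] the value 0. *)
have N0 : normal lam b != 0.
  apply: contraTneq B_gt0 => N; have [_ /iffRL/(_ x0S)] := HB x0 x0S.1.
  by rewrite N mulmx0 mxE => <-; rewrite ltxx.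
split.
  exists (normal lam b), B; split=> [_ [x xc <-]|]; first by have [] := HB x xc.
  apply/seteqP; split=> [_ [x xS <-]|y [[x xc <-]]] /=.
    by split; [exists x => //; case: xS | exact: ((HB x xS.1).2.2 xS)].
  by move=> /(HB x xc).2.1 xS; exists x.
exists d.-1; rewrite prednK //; split; first exact: has_affdim_ncp.
split; first by exists (proj dn x0); exists x0.
exists (hyperplane (normal lam b)); split.
- move=> _ _ [x xS <-] [y yS <-]; rewrite mem_hyperplane mulmxBl !mxE.
  have := (HB x xS.1).2.2 xS; have := (HB y yS.1).2.2 yS.
  by rewrite !mxE => -> ->; rewrite subrr.
- move=> W HW; apply/subvP => y; rewrite mem_hyperplane => /eqP yc.
  have [v <- vS] := row_kernel_lift uniq rel yc.
  exact: proj_sface_dir HW vS.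
- by rewrite -[in RHS](dim_hyperplane N0).
Qed.

(** Writing the normal of [F] as a nonnegative combination of rows with support [S] shows that [F]
    is the image of the face tight on [S]. Genericity forces the size of [S], and positivity gives
    the signs. *)
Lemma gale_of_facet F : facet (ncp dn e) F ->
  exists S (b : {ffun 'I_n -> bool}), [/\ #|S| = m.+1, gale_signs S b &
    forall x, cube e x -> F (proj dn x) <-> sface e S b x].
Proof.
case=> [[c [B [QB FE]]] [k [Qk Fk]]].
have kd : k.+1 = d := has_affdim_uniq Qk has_affdim_ncp.
have [lam [b [lam_ge rel cE]]] := normal_exists c.
pose S := [set i | lam i != 0]%SET.
have suppN i : i \notin S -> lam i = 0 by rewrite inE negbK => /eqP.
have := proj_sface_eq lam_ge rel; rewrite cE -/S /=; set B' := \sum_(i < n) _ => HB.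
have [x0 [x0S _]] := sface_interior e_gt0 e_le1 S b.
(* Both are the maximum of the functional: [B] is attained on the nonempty [F], and [B'] at [x0]. *)
have BB' : B = B'.
  apply/eqP; rewrite eq_le; apply/andP; split.
    case: Fk => [[y]]; rewrite FE => -[[x xc <-] <-] _; by case: (HB x xc).
  by rewrite -((HB x0 x0S.1).2.2 x0S); apply: QB; exists x0 => //; case: x0S.
have FS x : cube e x -> F (proj dn x) <-> sface e S b x.
  move=> xc; rewrite FE BB' /=; split=> [[_ /(HB x xc).2.1 //]|xS].
  by split; [exists x | exact: ((HB x xc).2.2 xS)].
have FP : F = proj dn @` sface e S b.
  apply/seteqP; split=> [y Fy|_ [x xS <-]]; last by apply/FS => //; case: xS.
  have [x xc xy] : ncp dn e y by move: Fy; rewrite FE => -[].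
  by exists x => //; apply/FS => //; rewrite xy.
have S0 : S != finset.set0.
  apply/eqP => E; move: Fk; rewrite FP E sface0 => Qk'.
  by have := has_affdim_uniq Qk Qk'; lia.
have mn : (m.+1 <= n)%N by rewrite /m; lia.
have Sm : #|S| = m.+1.
  case: (ltngtP #|S| m.+1) => // Slt.
    (* If [S] is too small, enlarge it to [m.+1] elements: [lam] is a nonzero multiple of a relation
       supported on the whole larger set. *)
    have [|S' [SS' _ S'm]] := set_between (finset.subsetT S) (k := m.+1).
      by rewrite (ltnW Slt) cardsT card_ord.
    have [lam' [supp' _ _ uniq' _]] := gen b S'm.
    have [i iS'|t lamt] := uniq' lam _ rel.
      by apply: suppN; apply: contra iS'; apply: (fintype.subsetP SS').
    have [i iS] := finset.set0Pn _ S0.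
    have t0 : t != 0.
      by move: iS; rewrite inE; apply: contraNneq => t0; rewrite lamt t0 mul0r.
    have E : S = S' by apply/finset.setP => j; rewrite inE lamt mulf_eq0 (negPf t0) supp'.
    by rewrite E S'm ltnn in Slt.
  (* If [S] is too large, the relation on [m.+1] of its elements has a normal that is constant on
     [F], hence proportional to [c]. Independence of the rows makes the two relations proportional,
     contrary to their supports. *)
  have [|S1 [_ S1S S1m]] := set_between (finset.sub0set S) (k := m.+1).
    by rewrite cards0 /= (ltnW Slt).
  have [lam1 [supp1 rel1 _ _ _]] := gen b S1m.
  have c0 : c != 0.
    apply: contra_eq_neq cE => /= c0; apply/eqP => N; case/negP: S0; apply/eqP/finset.setP => i.
    by rewrite !inE (normal_inj0 rel) ?eqxx ?N.
  have [_ [V [Vd Vmin Vk]]] := Fk.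
  have Veq : V = hyperplane c.
    apply/eqP; rewrite eqEdim Vk; apply/andP; split; last first.
      by have := dim_hyperplane c0; lia.
    apply: Vmin => x y; rewrite FE => -[_ xB] [_ yB].
    by rewrite mem_hyperplane mulmxBl mxE xB mxE yB subrr.
  have sub : (V <= hyperplane (normal lam1 b))%VS.
    apply: Vmin => x' y'; rewrite FP => -[x [_ xS] <-] [y [_ yS] <-].
    rewrite mem_hyperplane mulmxBl mxE [X in _ + X]mxE !normalE // -sumrB big1 // => i _.
    have [iS1|iS1] := boolP (i \in S1); last first.
      by rewrite -supp1 negbK in iS1; rewrite (eqP iS1) !mul0r subrr.
    by rewrite xS ?yS ?subrr //; apply: (fintype.subsetP S1S).
  rewrite Veq in sub; have [t tE] := hyperplane_sub c0 sub.
  have lamE i : lam1 i = t * lam i.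
    apply/eqP; rewrite -subr_eq0; apply/eqP; move: i.
    have rel' : relation m e b (fun i => lam1 i - t * lam i).
      move=> j jm; rewrite (eq_bigr (fun i => lam1 i * rowc e (b i) i j -
        t * (lam i * rowc e (b i) i j))) => [|i _]; last by rewrite mulrBl mulrA.
      by rewrite sumrB -mulr_sumr rel // rel1 // mulr0 subrr.
    apply: (normal_inj0 rel'); apply/colP => j; rewrite [RHS]mxE.
    rewrite mxE (eq_bigr (fun i => lam1 i * rowc e (b i) i (pidx j) -
        t * (lam i * rowc e (b i) i (pidx j)))) => [|i _]; last by rewrite mulrBl mulrA.
    rewrite sumrB -mulr_sumr; move/colP/(_ j): tE; rewrite -cE !mxE => ->.
    by rewrite subrr.
  have [i iS1] : exists i, i \in S1 by apply/card_gt0P; rewrite S1m.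
  have t0 : t != 0.
    by move: iS1; rewrite -supp1; apply: contraNneq => t0; rewrite lamE t0 mul0r.
  have E : S1 = S by apply/finset.setP => j; rewrite inE -supp1 lamE mulf_eq0 (negPf t0).
  by rewrite -E S1m ltnn in Slt.
exists S, b; split=> //.
(* The generic relation has a positive entry, so [lam] is a positive multiple of it. *)
have [lam' [supp' _ [i iS li] uniq' gE]] := gen b Sm.
apply/gE => j jS; have [t lamt] := uniq' lam suppN rel.
have pos l : l \in S -> 0 < lam l by rewrite inE lt_neqAle eq_sym lam_ge => ->.
have t0 : 0 < t by have := pos i iS; rewrite lamt pmulr_lgt0.
by have := pos j jS; rewrite lamt pmulr_rgt0.
Qed.

End ProjectedCube.

(** * Signed index sets and Gale evenness *)

Section SignedIndexSets.
Variable n : nat.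
Implicit Types (S : {set 'I_n}) (b : 'I_n -> bool) (alpha : {fset int}).

(** [supp_of] and [neg_of] split a signed set into indices and signs, and [fset_of] reassembles it;
    [i] stands for the label [i.+1]. *)
Definition supp_of alpha : {set 'I_n} :=
  [set i : 'I_n | (i.+1%:Z \in alpha) || (- i.+1%:Z \in alpha)]%SET.

Definition neg_of alpha : {ffun 'I_n -> bool} := [ffun i : 'I_n => - i.+1%:Z \in alpha].

Definition signed_index b (i : 'I_n) : int := (-1) ^+ b i * i.+1%:Z.

Definition fset_of S b : {fset int} := [fset x in [seq signed_index b i | i <- enum S]]%fset.

Lemma signed_index_inj b : injective (signed_index b).
Proof.
move=> i j /(congr1 absz); rewrite /signed_index !abszMsign /= => -[] ij.
exact: val_inj.
Qed.

Lemma mem_fset_of S b (a : int) : (a \in fset_of S b) = [exists i in S, a == signed_index b i].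
Proof.
rewrite in_fset /=; apply/mapP/exists_inP => [[i]|[i iS /eqP ai]].
  by rewrite mem_enum => iS ->; exists i.
by exists i; rewrite ?mem_enum.
Qed.

Lemma card_fset_of S b : #|` fset_of S b| = #|S|.
Proof.
rewrite card_fseq undup_id ?size_map -?cardE // map_inj_uniq ?enum_uniq //.
exact: signed_index_inj.
Qed.

Lemma neg_notin alpha (a : int) :
  (alpha `&` [fset - a | a in alpha] = fset0)%fset -> a \in alpha -> - a \notin alpha.
Proof.
move=> /fsetP/(_ (- a)); rewrite in_fsetI in_fset0 => + aA.
have -> : - a \in [fset - a | a in alpha]%fset by apply/imfsetP; exists a.
by rewrite andbT => ->.
Qed.

Lemma fset_of_supp alpha : (forall a, a \in alpha -> (1 <= `|a| <= n)%N) ->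
    (alpha `&` [fset - a | a in alpha] = fset0)%fset ->
  fset_of (supp_of alpha) (neg_of alpha) = alpha.
Proof.
move=> range disj; apply/fsetP => a; rewrite mem_fset_of.
apply/exists_inP/idP => [[i]|aA].
  rewrite inE /signed_index ffunE => /orP[|] iA /eqP ->; last by rewrite iA mulN1r.
  by rewrite (negPf (neg_notin disj iA)) mul1r.
have /andP[a1 an] := range a aA.
have an' : (`|a|.-1 < n)%N by rewrite prednK.
exists (Ordinal an'); rewrite ?inE /signed_index ?ffunE /= prednK //.
  by case: a aA {a1 an an'} => k /=; [move=> -> | rewrite NegzE => ->; rewrite orbT].
case: (intP a) aA a1 {an an'} => // k kA _ /=.
  by rewrite (negPf (neg_notin disj kA)) mul1r.
by rewrite kA mulN1r.
Qed.

Lemma supp_fset_of S b : supp_of (fset_of S b) = S.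
Proof.
apply/finset.setP => i; rewrite inE !mem_fset_of; apply/orP/idP.
  case=> /exists_inP[j jS /eqP/(congr1 absz)]; rewrite ?abszN /signed_index abszMsign /=;
    by case=> ij; rewrite (_ : i = j) //; apply: val_inj.
move=> iS; case E : (b i); [right|left]; apply/exists_inP; exists i => //;
  by rewrite /signed_index E ?mulN1r ?mul1r.
Qed.

Lemma neg_fset_of S b i : i \in S -> neg_of (fset_of S b) i = b i.
Proof.
move=> iS; rewrite ffunE mem_fset_of; apply/exists_inP/idP => [[j jS]|bi].
  rewrite /signed_index => /eqP; case E : (b j).
    by rewrite mulN1r => /oppr_inj [ij]; rewrite (_ : i = j) //; apply: val_inj.
  by rewrite mul1r.
by exists i; rewrite // /signed_index bi mulN1r.
Qed.

Lemma signed_fset_of S b d : #|S| = (n - d + 1)%N -> signed_subset n d (fset_of S b).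
Proof.
move=> Sd; split=> [a||]; last first.
- apply/fsetP => a; rewrite in_fsetI in_fset0; apply/negbTE/negP.
  case/andP; rewrite mem_fset_of => /exists_inP[i iS /eqP ->] /imfsetP[a' /=].
  rewrite mem_fset_of => /exists_inP[j jS /eqP ->] E.
  have ij : i = j.
    apply: val_inj; move: E => /(congr1 absz); rewrite abszN /signed_index !abszMsign /=.
    by case.
  move: E; rewrite ij /signed_index => /eqP; rewrite -addr_eq0 -mulrDr mulf_eq0 signr_eq0 /=.
  by [].
- by rewrite card_fset_of.
- rewrite mem_fset_of => /exists_inP[i iS /eqP ->].
  by rewrite /signed_index abszMsign /= ltn_ord.
Qed.

Lemma cube_face_supp (R : realType) (e : R) alpha :
    (alpha `&` [fset - a | a in alpha] = fset0)%fset ->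
  cube_face e alpha = sface e (supp_of alpha) (neg_of alpha).
Proof.
move=> disj; apply/seteqP; split=> x [xc H]; split=> // i.
  rewrite inE rowvE ffunE; case: (boolP (- _ \in _)) => [iA _|_]; last rewrite orbF => iA.
    rewrite expr1; have := H i (-1) (or_intror erefl).
    by rewrite [X in X \in _]mulN1r mulrN1z => /(_ iA).
  by rewrite expr0; have := H i 1 (or_introl erefl); rewrite [X in X \in _]mul1r => /(_ iA).
move=> s s1 iA; have iS : i \in supp_of alpha.
  by rewrite inE; case: s1 iA => ->; rewrite ?mul1r ?mulN1r => ->; rewrite ?orbT.
have := H i iS; rewrite rowvE ffunE; case: s1 iA => ->.
  by rewrite mul1r => /(neg_notin disj)/negPf ->.
by rewrite mulN1r => ->; rewrite expr1 mulrN1z.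
Qed.

Lemma sface_eq (R : realType) (e : R) S b b' : {in S, b =1 b'} -> sface e S b = sface e S b'.
Proof.
by move=> bb'; apply/seteqP; split=> x [xc H]; split=> // i iS; have := H i iS; rewrite bb'.
Qed.

Lemma gale_signs_eq S b b' : {in S, b =1 b'} -> gale_signs S b -> gale_signs S b'.
Proof. by move=> bb' H i j ij; rewrite -bb'; [exact: H | case: ij]. Qed.

End SignedIndexSets.

(** * Gale evenness as a condition on neighbouring elements *)

Section GaleEvenness.
Implicit Types (A : {fset nat}) (alpha : {fset int}).

Definition neighbours A (i j : nat) : Prop :=
  [/\ i \in A, j \in A, (i < j)%N & forall k, (i < k < j)%N -> k \notin A].

(** Between neighbours all [j - i - 1] integers are missing, and the count for a longer interval
    splits at any member inside it. *)
Lemma simplicial_gale_neighbours A :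
  simplicial_gale A <-> forall i j, neighbours A i j -> odd (i + j).
Proof.
split=> [H i j [iA jA ij between]|H].
  have := H i j iA jA ij.
  rewrite (eq_in_count (a2 := predT)) ?count_predT ?size_iota => [|k]; last first.
    by rewrite mem_index_iota => /between ->.
  lia.
suff main k : forall i j, (j - i <= k)%N -> i \in A -> j \in A -> (i < j)%N ->
    ~~ odd (count (fun k => k \notin A) (index_iota i.+1 j)).
  by move=> i j; apply: (main (j - i)%N).
elim: k => [|k IH] i j jik iA jA ij; first by lia.
have [/hasP[l]|/hasPn none] := boolP (has [in A] (index_iota i.+1 j)).
  rewrite mem_index_iota => /andP[il lj] lA.
  rewrite /index_iota (_ : (j - i.+1 = (l - i.+1) + (j - l.+1).+1)%N); last by lia.
  rewrite iotaD count_cat (_ : (i.+1 + (l - i.+1))%N = l); last by lia.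
  rewrite /= lA add0n oddD.
  have [il' lj'] : (l - i <= k)%N /\ (j - l <= k)%N by lia.
  by rewrite (negPf (IH i l il' iA lA il)) (negPf (IH l j lj' lA jA lj)).
rewrite (eq_in_count (a2 := predT)) => [|l /none -> //].
rewrite count_predT size_iota; have : odd (i + j); last by lia.
by apply: H; split=> // l lij; apply: none; rewrite mem_index_iota.
Qed.

Definition prefix_fset A (i : nat) : bool := all [in A] (iota 1 i).

(** [gale_signs] for labels starting at 1: the shift flips the parity of [j] and keeps that of
    [i + j]. *)
Definition gale_links alpha : Prop := forall i j, neighbours (abs_fset alpha) i j ->
  if prefix_fset (abs_fset alpha) i then (- i%:Z \in alpha) = ~~ odd j else odd (i + j).

Lemma mem_abs_fset alpha (k : nat) :
  (k \in abs_fset alpha) = (k%:Z \in alpha) || (- k%:Z \in alpha).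
Proof.
apply/imfsetP/orP => [[a aA ->]|[kA|kA]].
- by case: a aA => l /=; [left | rewrite NegzE; right].
- by exists k%:Z.
- by exists (- k%:Z); rewrite //= abszN.
Qed.

Lemma gale_signs_links n alpha : (forall a, a \in alpha -> (1 <= `|a| <= n)%N) ->
  gale_signs (supp_of n alpha) (neg_of n alpha) <-> gale_links alpha.
Proof.
move=> range; set A := abs_fset alpha.
have rangeA k : k \in A -> (1 <= k <= n)%N by case/imfsetP => a /range aA ->.
have mem_supp (i : 'I_n) : (i \in supp_of n alpha) = (i.+1 \in A).
  by rewrite inE mem_abs_fset.
have consE (i j : 'I_n) : consecutive (supp_of n alpha) i j <-> neighbours A i.+1 j.+1.
  split=> [[iS jS ij H]|[iS jS ij H]].
    split=> //; rewrite -?mem_supp // => -[//|k] /andP[ik kj].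
    have kn : (k < n)%N by apply: ltn_trans (ltn_ord j).
    by have := H (Ordinal kn); rewrite mem_supp; apply; apply/andP; split.
  by split; rewrite ?mem_supp // => k kij; rewrite mem_supp; apply: H.
have prefE (i : 'I_n) : prefix_in (supp_of n alpha) i = prefix_fset A i.+1.
  apply/forallP/allP => H => [k|k].
    rewrite mem_iota => /andP[k1 ki].
    have kn : (k.-1 < n)%N by have := ltn_ord i; lia.
    have /implyP := H (Ordinal kn); rewrite mem_supp /= prednK //; apply; lia.
  by apply/implyP => ki; rewrite mem_supp; apply: H; rewrite mem_iota.
split=> H i j ij.
  case: (ij) => /rangeA/andP[i1 iN] /rangeA/andP[j1 jN] _ _.
  have in' : (i.-1 < n)%N by rewrite prednK.
  have jn' : (j.-1 < n)%N by rewrite prednK.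
  have := H (Ordinal in') (Ordinal jn'); rewrite prefE ffunE /= prednK //.
  move=> /(_ _); rewrite (_ : odd (i.-1 + j.-1) = odd (i + j)); last by lia.
  rewrite (_ : odd j.-1 = ~~ odd j); last by lia.
  by apply; apply/consE; rewrite /= !prednK.
move: ij => /consE /H; rewrite prefE ffunE -/A.
by case: ifP => _; rewrite /= ?negbK // addnS /= negbK.
Qed.

Lemma abs_fset_min A : A != fset0 -> exists m, is_min A m.
Proof.
move=> /fset0Pn ex; case: (ex_minnP ex) => m mA mmin; exists m; split=> // j; exact: mmin.
Qed.

Lemma pm1_mul_in alpha (s : int) (k : nat) : s = 1 \/ s = -1 ->
    (alpha `&` [fset - a | a in alpha] = fset0)%fset -> s * k%:Z \in alpha ->
  (- k%:Z \in alpha) = (s == -1).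
Proof.
move=> [] -> disj; rewrite ?mul1r ?mulN1r; last by move=> ->.
by move=> /(neg_notin disj)/negPf ->.
Qed.

Lemma signr_int (k : nat) : (-1 : int) ^+ k = if odd k then -1 else 1.
Proof. by rewrite -signr_odd; case: odd. Qed.

(** For [p = 0] the label 1 is missing and no element has a full prefix. Otherwise a link starts
    inside the run, or leads from [p] to the least element of [beta], or lies within [beta]. *)
Lemma cubical_gale_links n d alpha : signed_subset n d alpha ->
  cubical_gale n d alpha -> gale_links alpha.
Proof.
move=> [range card disj] [[p1 m1 /simplicial_gale_neighbours G] i j ij|].
  rewrite ifF ?G //; apply/negbTE/negP => /allP/(_ 1%N).
  rewrite mem_iota mem_abs_fset (negPf p1) (negPf m1).
  have : i \in abs_fset alpha by case: ij.
  case/imfsetP => a /range/andP[a1 _] iE.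
  have i1 : (1 < 1 + i)%N by rewrite iE add1n ltnS.
  by rewrite i1 => /(_ isT).
case=> p [/andP[p1 pnd] [s [beta [s1 alphaE _ Hbeta]]]] i j ij.
set A := abs_fset alpha in ij *; set B := abs_fset beta in Hbeta *.
have memA k : (k \in A) = (1 <= k <= p)%N || (k \in B).
  apply/imfsetP/orP => [[a aA ->]|].
    move: aA; rewrite alphaE /= !in_fsetU in_fset1 => /orP[/orP[|]|aB].
    - case/imfsetP => l /=; rewrite mem_iota => lp ->; left.
      by rewrite abszMsign /=; lia.
    - move=> /eqP ->; left; rewrite abszM /= (_ : `|s|%N = 1%N) ?mul1n ?p1 ?leqnn //.
      by case: s1 => ->.
    - by right; apply/imfsetP; exists a.
  case=> [/andP[k1 kp]|/imfsetP[a aB ->]]; last first.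
    by exists a; rewrite // alphaE /= in_fsetU aB orbT.
  have [kp'|pk] := ltnP k p.
    exists ((-1) ^+ k * k%:Z); last by rewrite abszMsign.
    rewrite /= alphaE !in_fsetU; apply/orP; left; apply/orP; left.
    by apply/imfsetP; exists k; rewrite //= mem_iota; lia.
  exists (s * p%:Z); last by rewrite abszM; case: s1 => -> /=; lia.
  by rewrite /= alphaE !in_fsetU in_fset1 eqxx orbT.
have HB k : k \in B -> exists m, [/\ is_min B m, (p + 1 < m)%N, simplicial_gale B,
    s = (-1) ^+ (p + 1) -> ~~ odd (m - p) & s = (-1) ^+ p -> odd (m - p)].
  by case/imfsetP => a aB _; apply: Hbeta; apply/fset0Pn; exists a.
have BA k : k \in B -> (p.+1 < k)%N.
  by move=> kB; have [m [[_ /(_ k kB) mk] pm _ _ _]] := HB k kB; lia.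
(* The label [p.+1] is missing, because [beta] starts beyond it. *)
have prefE : prefix_fset A i = (i <= p)%N.
  apply/allP/idP => [H|ip k].
    rewrite leqNgt; apply/negP => pi; have := H p.+1.
    rewrite mem_iota /= memA ltnn /= add1n ltnS pi => /(_ isT) /BA; by rewrite ltnn.
  by rewrite mem_iota memA => ki; apply/orP; left; lia.
have inA (t : int) k : (t = 1 \/ t = -1) -> t * k%:Z \in alpha ->
    (- k%:Z \in alpha) = (t == -1) by move=> t1; apply: pm1_mul_in.
rewrite prefE; have [iA jA ilj between] := ij.
have i1 : (1 <= i)%N by case/imfsetP: iA => a /range/andP[a1 _] ->.
case: (ltngtP i p) => ip.
- have jE : j = i.+1.
    apply/eqP; rewrite eqn_leq ilj andbT leqNgt; apply/negP => lt.
    by have := between i.+1; rewrite ltnSn lt memA ip => /(_ isT).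
  rewrite (inA ((-1) ^+ i)) ?signr_int ?jE /= ?negbK; try by case: (odd i); [right|left].
    by case: (odd i).
  rewrite -signr_int alphaE !in_fsetU; apply/orP; left; apply/orP; left.
  by apply/imfsetP; exists i; rewrite //= mem_iota; lia.
- have BE k : (i <= k)%N -> (k \in A) = (k \in B).
    by move=> ik; rewrite memA; case: (k \in B); lia.
  have iB : i \in B by rewrite -BE.
  have [m [_ _ /simplicial_gale_neighbours G _ _]] := HB i iB.
  apply: G; split=> //; first by rewrite -BE // ltnW.
  by move=> k /andP[ik kj]; rewrite -(BE k (ltnW ik)); apply: between; rewrite ik.
- rewrite (inA s) //; last by rewrite ip alphaE !in_fsetU in_fset1 eqxx orbT.
  have jB : j \in B by move: jA; rewrite memA; case: (j \in B) => //; lia.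
  have [m [[mB mmin] pm _ sp1 sp2]] := HB j jB.
  have jm : j = m.
    apply/eqP; rewrite eqn_leq mmin // andbT leqNgt; apply/negP => lt.
    by have := between m; rewrite lt memA mB orbT andbT ip => /(_ (ltnW _)); lia.
  have lepm : (p <= m)%N by rewrite (leq_trans _ (ltnW pm)) ?leq_addr.
  rewrite jm; move: sp1 sp2; rewrite addn1 !signr_int oddB //=.
  by case: s1 => ->; case: (odd p); case: (odd m) => //= sp1 sp2;
    [have := sp1 erefl | have := sp2 erefl | have := sp2 erefl | have := sp1 erefl].
Qed.

(** Take [p] as the length of the initial run of labels. The links inside the run force the signs
    below [p]; the sign at [p] is [s], and the larger labels form [beta]. *)
Lemma links_cubical_gale n d alpha : signed_subset n d alpha ->
  gale_links alpha -> cubical_gale n d alpha.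
Proof.
move=> [range card disj] G; set A := abs_fset alpha in G.
have rangeA k : k \in A -> (1 <= k <= n)%N by case/imfsetP => a /range aA ->.
have [A1|A1] := boolP (1%N \in A); last first.
  left; split.
  - by apply: contra A1 => H; rewrite mem_abs_fset H.
  - by apply: contra A1 => H; rewrite mem_abs_fset H orbT.
  apply/simplicial_gale_neighbours => i j ij; have := G i j ij.
  rewrite ifF //; apply/negbTE; apply: contra A1 => /allP; apply.
  by rewrite mem_iota; case: ij => /rangeA; lia.
right.
have ex : exists k, k.+1 \notin A.
  by exists n; apply/negP => /rangeA; rewrite ltnn andbF.
case: (ex_minnP ex) => p pA pmin; exists p.
have runA k : (1 <= k <= p)%N -> k \in A.
  case: k => // k kp; apply: contraT => /pmin; lia.
have p1 : (0 < p)%N by rewrite lt0n; apply: contraNneq pA => ->.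
pose s : int := if p%:Z \in alpha then 1 else -1.
pose sg k : int := if (k < p)%N then (-1) ^+ k else s.
have sg1 k : sg k = 1 \/ sg k = -1.
  by rewrite /sg /s signr_int; do 2! case: ifP => _; by [left | right].
have sgE k : (1 <= k <= p)%N -> (- k%:Z \in alpha) = (sg k == -1).
  move=> kp; rewrite /sg; case: ltnP => [kp'|pk].
    have := G k k.+1; rewrite ifT; last first.
      by apply/allP => l; rewrite mem_iota => lk; apply: runA; lia.
    rewrite /= negbK signr_int => ->; first by case: (odd k).
    by split; rewrite ?runA ?ltnSn //; try lia; move=> l; lia.
  have -> : k = p by lia.
  rewrite /s; have := runA p; rewrite p1 leqnn mem_abs_fset => /(_ isT).
  by case: ifP => [/(neg_notin disj)/negPf -> |_ /= ->].
have sg_in k : (1 <= k <= p)%N -> sg k * k%:Z \in alpha.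
  move=> kp; have := runA k kp; rewrite mem_abs_fset sgE //.
  by case: (sg1 k) (sgE k kp) => -> /=; rewrite ?mul1r ?mulN1r ?orbF // => ->.
pose beta := [fset a in alpha | (p < `|a|)%N]%fset.
pose L := [fset x in [seq sg k * k%:Z | k <- iota 1 p]]%fset.
have absL k : `|(sg k * k%:Z)%R|%N = k.
  by rewrite abszM; case: (sg1 k) => ->; rewrite /= mul1n.
have cardL : #|` L| = p.
  rewrite card_fseq undup_id ?size_map ?size_iota // map_inj_in_uniq ?iota_uniq //.
  by move=> k l _ _ /(congr1 absz); rewrite !absL.
have LU : alpha = (L `|` beta)%fset.
  apply/fsetP => a; rewrite in_fsetU in_fset !inE /=.
  apply/idP/orP => [aA|[/mapP[k]|/andP[]//]]; last first.
    by rewrite mem_iota => kp ->; apply: sg_in; lia.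
  have [pa|ap] := ltnP p `|a|; [by right; rewrite aA | left].
  have a1 := range a aA; have ka : (1 <= `|a| <= p)%N by case/andP: a1 => ->.
  apply/mapP; exists `|a|%N; first by rewrite mem_iota; lia.
  have := sgE _ ka; case: (sg1 `|a|%N) => ->; rewrite ?mul1r ?mulN1r.
    case: a aA {a1 ka ap} => // k; rewrite NegzE => kA /=.
    by rewrite kA.
  case: a aA {a1 ka ap} => k kA /=; last by rewrite NegzE.
  by rewrite (negPf (neg_notin disj kA)).
have disjL : [disjoint L & beta]%fset.
  apply/fdisjointP => a; rewrite in_fset /= => /mapP[k]; rewrite mem_iota => kp ->.
  by rewrite !inE absL /=; apply/negP => /andP[_]; lia.
have cardb : (p + #|` beta| = n - d + 1)%N.
  by rewrite -card LU cardfsU (disjoint_fsetI0 disjL) cardfs0 subn0 cardL.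
split; first by lia.
exists s, beta; split.
- by have := sg1 p; rewrite /sg ltnn.
- rewrite [LHS]LU; congr (_ `|` _)%fset; apply/fsetP => a.
  rewrite in_fset in_fsetU in_fset1 /=; apply/mapP/orP => [[k]|[/imfsetP[k /=]|/eqP ->]].
  + rewrite mem_iota => kp ->; rewrite /sg; case: ltnP => kp'; last first.
      by right; rewrite (_ : k = p) //; lia.
    by left; apply/imfsetP; exists k; rewrite //= mem_iota; lia.
  + rewrite mem_iota => kp ->; exists k; rewrite ?mem_iota; first by lia.
    by rewrite /sg ifT //; lia.
  + by exists p; rewrite ?mem_iota ?/sg ?ltnn //; lia.
- by lia.
move=> beta0; set B := abs_fset beta.
have memB k : (k \in B) = (k \in A) && (p < k)%N.
  rewrite !mem_abs_fset !inE /= abszN /= -andb_orl.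
  by [].
have [m [mB mmin]] : exists m, is_min B m.
  apply: abs_fset_min; case/fset0Pn: beta0 => a aB; apply/fset0Pn; exists `|a|%N.
  by apply/imfsetP; exists a.
have /andP[mA pm] : (m \in A) && (p < m)%N by rewrite -memB.
have pm' : (p + 1 < m)%N.
  by rewrite addn1 ltn_neqAle pm andbT; apply: contraNneq pA => ->.
(* The link from [p] to the least element of [beta] ties [s] to the parity of [m]. *)
have Gpm : (- p%:Z \in alpha) = ~~ odd m.
  have := G p m; rewrite ifT; last first.
    by apply/allP => l; rewrite mem_iota => lk; apply: runA; lia.
  apply; split=> //; first by apply: runA; rewrite p1 /=.
  move=> k /andP[pk km]; apply/negP => kA; have := mmin k; rewrite memB kA pk.
  by move=> /(_ isT); lia.
have sE : (s == -1) = ~~ odd m by rewrite -Gpm sgE ?p1 ?leqnn // /sg ltnn.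
exists m; split=> //.
- apply/simplicial_gale_neighbours => i j [iB jB ij between].
  have /andP[iA pi] : (i \in A) && (p < i)%N by rewrite -memB.
  have /andP[jA pj] : (j \in A) && (p < j)%N by rewrite -memB.
  have := G i j; rewrite ifF; last first.
    apply/negbTE; apply: contra pA => /allP; apply.
    by rewrite mem_iota add1n ltnS.
  apply; split=> // k kij; have := between k kij; rewrite memB negb_and.
  by case/andP: kij => /(ltn_trans pi) -> _; rewrite orbF.
- move: sE; rewrite oddB 1?ltnW // addn1 => + sE'; rewrite sE' signr_int /=.
  by case: (odd p); case: (odd m).
- move: sE; rewrite oddB 1?ltnW // => + sE'; rewrite sE' signr_int.
  by case: (odd p); case: (odd m).
Qed.

End GaleEvenness.

(** * The criterion for all sufficiently small parameters *)

Theorem theorem18 (R : realType) (n d : nat) (d2 : (2 <= d)%N)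
    (dn : (d <= n)%N) :
  exists2 e0 : R, 0 < e0 & forall e : R, 0 < e -> e <= 1 -> e < e0 ->
    (forall F : set 'rV[R]_d,
       facet (ncp dn e) F <->
       exists alpha : {fset int},
         [/\ signed_subset n d alpha, cubical_gale n d alpha
           & F = proj dn @` @cube_face R n e alpha]) /\
    (forall alpha : {fset int}, signed_subset n d alpha ->
       facet (ncp dn e) (proj dn @` @cube_face R n e alpha) ->
       cubical_gale n d alpha).
Proof.
have d0 : (0 < d)%N := ltnW d2.
have [e0 e0p gen] := small_generic R n (n - d).
exists e0 => // e ep e1 ee0; have {}gen := gen e ep ee0.
have cardS alpha : signed_subset n d alpha -> #|supp_of n alpha| = (n - d).+1.
  move=> [range card disj].
  by rewrite -(card_fset_of _ (neg_of n alpha)) fset_of_supp // card addn1.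
have to_links alpha : signed_subset n d alpha ->
    cubical_gale n d alpha <-> gale_signs (supp_of n alpha) (neg_of n alpha).
  move=> sgn; have [range _ _] := sgn; rewrite gale_signs_links //.
  by split; [apply: cubical_gale_links | apply: links_cubical_gale].
split=> [F|alpha sgn].
  split=> [FF|[alpha [sgn gal ->]]]; last first.
    have [_ _ disj] := sgn; rewrite cube_face_supp //.
    by apply: (facet_of_gale dn d0 ep e1 gen); [exact: cardS | apply/to_links].
  have [S [b [Sm gS FS]]] := gale_of_facet d0 ep e1 gen FF.
  have Sd : #|S| = (n - d + 1)%N by rewrite Sm addn1.
  have sgn := signed_fset_of b Sd; have [_ _ disj] := sgn.
  have bE : {in S, b =1 neg_of n (fset_of S b)} by move=> i iS; rewrite neg_fset_of.
  exists (fset_of S b); split=> //.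
    by apply/to_links => //; rewrite supp_fset_of; apply: gale_signs_eq gS.
  rewrite cube_face_supp // supp_fset_of -(sface_eq _ bE).
  have [[c [B [_ FE]]] _] := FF.
  apply/seteqP; split=> [y Fy|_ [x xS <-]]; last by apply/FS => //; case: xS.
  have [x xc xy] : ncp dn e y by move: Fy; rewrite FE => -[].
  by exists x => //; apply/FS => //; rewrite xy.
have [_ _ disj] := sgn; rewrite cube_face_supp // => FF; apply/to_links => //.
have [S [b [Sm gS FS]]] := gale_of_facet d0 ep e1 gen FF.
(* At a relative interior point only the inequalities of [alpha] are tight. Those of the index set
   [S] of the facet are tight there too, so [S] lies in the support with the same signs, and the
   cardinalities agree. *)
have [x [xS xlt]] := sface_interior ep e1 (supp_of n alpha) (neg_of n alpha).
have [_ xb] : sface e S b x by apply/FS; [case: xS | exists x].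
have sub i : i \in S -> i \in supp_of n alpha /\ b i = neg_of n alpha i.
  move=> iS; have [/andP[iA /eqP //]|/xlt] := boolP ((i \in supp_of n alpha) && (b i == neg_of n alpha i)).
  by rewrite xb // ltxx.
have SE : S = supp_of n alpha.
  apply/eqP; rewrite eqEcard cardS // Sm leqnn andbT.
  by apply/fintype.subsetP => i /sub[].
by rewrite -SE; apply: gale_signs_eq gS => i /sub[].
Qed.
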